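(* Let $\tilde P=(\mathbb Z,\preceq)$ be an affine poset of order $n$. Then the set $\bigcap_\tau h_\tau\subseteq \mathbb R^{\tilde P}/\mathcal C$, where the intersection runs over all proper tubes $\tau$ of $\tilde P$, is a realization of the affine poset cyclohedron $\mathscr C(\tilde P)$: it is a simple convex polytope of dimension $n-1$ whose face lattice is isomorphic to the set of proper tubings of $\tilde P$ ordered by reverse inclusion (vertices corresponding to maximal tubings).
   Context: An affine poset of order $n\ge1$ is a poset $\tilde P=(\mathbb Z,\preceq)$ such that (1) $i\preceq i+n$ for all $i$; (2) $i\preceq j\iff i+n\preceq j+n$ for all $i,j$; (3) for all $i,j\in\mathbb Z$ there is $k\in\mathbb Z$ with $i\preceq j+kn$. Write $i\lessdot j$ for a covering relation of $\tilde P$. A subset $\tau$ is connected if it induces a connected subgraph of the Hasse diagram, and convex if $a,c\in\tau$, $a\preceq b\preceq c$ imply $b\in\tau$. A tube is a connected convex subset $\tau$ with $|\tau|\ge2$ such that either $\tau=\tilde P$ or $\tau$ contains at most one element of each residue class mod $n$; a tube is proper if $\tau\ne\tilde P$. Two tubes are nested if one contains the other, disjoint if they do not intersect; for disjoint tubes $\sigma,\tau$ write $\sigma\prec\tau$ if there are $a\in\sigma,b\in\tau$ with $a\prec b$. A set $T$ of tubes is $n$-periodic if $\tau\in T$ implies $\tau+kn\in T$ for all $k\in\mathbb Z$. A proper tubing is an $n$-periodic set of proper tubes, pairwise nested or disjoint, such that whenever $\tau_1\prec\cdots\prec\tau_k$ in $T$ then $\tau_k\not\prec\tau_1$; it is maximal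 if maximal by inclusion. The affine poset cyclohedron $\mathscr C(\tilde P)$ is the (combinatorial type of) simple convex polytope of dimension $n-1$ whose face lattice is isomorphic to the set of proper tubings ordered by reverse inclusion. Let $c=n^{2(n+1)}$ and let $\mathbb R^{\tilde P}$ be the space of bi-infinite real sequences $(\tilde x_i)_{i\in\mathbb Z}$ with $\tilde x_{i+n}=\tilde x_i+c$ for all $i$; let $\mathbb R^{\tilde P}/\mathcal C$ denote this space modulo adding a constant to all entries. For finite $\tau\subseteq\mathbb Z$ define $\alpha_\tau(\tilde x)=\sum_{i\lessdot j,\ i,j\in\tau}(\tilde x_j-\tilde x_i)$ (well defined on the quotient), $h_\tau=\{p:\alpha_\tau(p)\ge n^{2|\tau|}\}$ and $H_\tau=\{p:\alpha_\tau(p)=n^{2|\tau|}\}$. *)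

(* Defs.v *)
From HB Require Import structures.
From mathcomp Require Import all_boot all_order all_algebra generic_quotient.
From mathcomp Require Import ring_quotient.
From mathcomp Require Import finmap.
From mathcomp Require Import all_classical all_reals.

Set Implicit Arguments.
Unset Strict Implicit.
Unset Printing Implicit Defensive.

Import Order.TTheory GRing.Theory Num.Theory.

Local Open Scope classical_set_scope.
Local Open Scope ring_scope.
Local Open Scope quotient_scope.
Local Open Scope card_scope.

Record affine_poset (n : nat) := AffinePoset {
  ap_le :> rel int;
  ap_refl : reflexive ap_le;
  ap_anti : antisymmetric ap_le;
  ap_trans : transitive ap_le;
  ap_le_addn : forall i : int, ap_le i (i + n%:Z);
  ap_le_shift : forall i j : int, ap_le i j = ap_le (i + n%:Z) (j + n%:Z);
  ap_cofinal : forall i j : int, exists k : int, ap_le i (j + k * n%:Z)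
}.

Section Tubings.
Variables (n : nat) (P : affine_poset n).
Implicit Types (i j : int) (s t : set int) (T : set (set int)).

Definition ap_lt i j := (i != j) && P i j.

Definition ap_cover i j :=
  ap_lt i j && `[< forall k, ~~ (ap_lt i k && ap_lt k j) >].

Definition hasse_adj i j := ap_cover i j || ap_cover j i.

Definition connected_in_hasse t :=
  forall i j, t i -> t j ->
  exists p : seq int,
    [/\ path hasse_adj i p, last i p = j & forall k, k \in p -> t k].

Definition ap_convex t := forall a b c, t a -> t c -> P a b -> P b c -> t b.

Definition tube t :=
  [/\ connected_in_hasse t, ap_convex t, `I_2 #<= t &
      t = setT \/
      forall i j, t i -> t j -> (i = j %[mod n%:Z])%Z -> i = j].

Definition proper_tube t := tube t /\ t <> setT.

Definition nested s t := s `<=` t \/ t `<=` s.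

Definition disjoint_tubes s t := s `&` t = set0.

Definition tube_prec s t :=
  disjoint_tubes s t /\ exists a b, [/\ s a, t b & ap_lt a b].

Definition shift_set t (k : int) : set int := [set i + k * n%:Z | i in t].

Definition proper_tubing T :=
  [/\ T `<=` proper_tube,
      forall t k, T t -> T (shift_set t k),
      forall s t, T s -> T t -> nested s t \/ disjoint_tubes s t &
      forall (k : nat) (t : nat -> set int),
        (forall l, (l <= k)%N -> T (t l)) ->
        (forall l, (l < k)%N -> tube_prec (t l) (t l.+1)) ->
        ~ tube_prec (t k) (t 0%N)].

Definition maximal_tubing T :=
  proper_tubing T /\ forall T', proper_tubing T' -> T `<=` T' -> T' = T.

End Tubings.

Section Polytopes.
Variables (R : realType) (V : lmodType R).
Implicit Types (A F : set V) (d : nat).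

Definition conv_hull m (p : 'I_m -> V) : set V :=
  [set x | exists a : 'I_m -> R,
     [/\ forall i, 0 <= a i, \sum_i a i = 1 & x = \sum_i a i *: p i]].

Definition aff_hull m (p : 'I_m -> V) : set V :=
  [set x | exists a : 'I_m -> R, \sum_i a i = 1 /\ x = \sum_i a i *: p i].

Definition aff_indep m (p : 'I_m -> V) :=
  forall a : 'I_m -> R,
    \sum_i a i = 0 -> \sum_i a i *: p i = 0 -> forall i, a i = 0.

(* The affine hull of A has dimension d; in particular A is nonempty. *)
Definition has_dim A d :=
  exists p : 'I_d.+1 -> V,
    [/\ forall i, A (p i), aff_indep p & A `<=` aff_hull p].

Definition polytope A := exists m (p : 'I_m -> V), A = conv_hull p.

(* The set where a valid linear inequality phi <= b is tight.  This includes
   A itself and the empty set. *)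
Definition face A F :=
  exists (phi : {linear V -> R^o}) (b : R),
    (forall x, A x -> phi x <= b) /\ F = A `&` [set x | phi x = b].

(* Nonempty, since no proper tubing corresponds to the empty face. *)
Definition nonempty_face A F := face A F /\ F !=set0.

Definition vertex A F := face A F /\ has_dim F 0.

Definition facet A F := face A F /\ exists d, has_dim F d /\ has_dim A d.+1.

Definition simple_polytope A d :=
  [/\ polytope A, has_dim A d &
      forall F, vertex A F -> [set G | facet A G /\ F `<=` G] #= `I_d].

End Polytopes.

Section Quotient.
Variable R : realType.

Definition constants : {pred (int -> R^o)} :=
  [pred x | `[< exists r, x = cst r >]].

Fact constants_zmod_closed : zmod_closed constants.
Proof.
split; first by apply/asboolP; exists 0.
move=> x y /asboolP[r ->] /asboolP[s ->].
by apply/asboolP; exists (r - s); apply/funext.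
Qed.
HB.instance Definition _ :=
  GRing.isZmodClosed.Build (int -> R^o) constants constants_zmod_closed.

(* The real vector space of all bi-infinite sequences modulo constants; the
   quasi-periodic sequences form an affine subspace of it. *)
Definition seq_mod_cst : Type := Quotient.quot constants.

HB.instance Definition _ := Choice.on seq_mod_cst.
HB.instance Definition _ := GRing.Zmodule.on seq_mod_cst.
HB.instance Definition _ := Quotient.on seq_mod_cst.

Lemma seq_mod_cstP (x y : int -> R^o) :
  reflect (exists r, x = y + cst r)
          (\pi_seq_mod_cst x == \pi_seq_mod_cst y).
Proof.
rewrite -[_ == _]/(x == y %[mod Quotient.quot constants]) -Quotient.idealrBE.
apply: (iffP (asboolP _)) => -[r e]; exists r.
  by rewrite -e addrC subrK.
by rewrite e addrC addKr.
Qed.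

Lemma pi_seq_modD (x y : int -> R^o) :
  \pi_seq_mod_cst (x + y) = \pi_seq_mod_cst x + \pi_seq_mod_cst y.
Proof. exact: (raddfD \pi_(Quotient.quot constants)). Qed.

Definition scale_mod (a : R) (p : seq_mod_cst) : seq_mod_cst :=
  \pi_seq_mod_cst (a *: repr p).

Lemma pi_seq_modZ (a : R) (x : int -> R^o) :
  \pi_seq_mod_cst (a *: x) = scale_mod a (\pi_seq_mod_cst x).
Proof.
apply/eqP/seq_mod_cstP.
have /eqP/seq_mod_cstP[r e] := reprK (\pi_seq_mod_cst x).
exists (- (a * r)); rewrite e; apply/funext => i.
by rewrite scalerDr; apply/esym; exact: addrK.
Qed.

Let scaleA (a b : R) p : scale_mod a (scale_mod b p) = scale_mod (a * b) p.
Proof.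
elim/quotW: p => x.
by rewrite -(pi_seq_modZ b) -(pi_seq_modZ (a * b)) -pi_seq_modZ scalerA.
Qed.
Let scale1 : left_id 1 scale_mod.
Proof. by elim/quotW => x; rewrite -pi_seq_modZ scale1r. Qed.
Let scaleDr : right_distributive scale_mod +%R.
Proof.
move=> a; elim/quotW => x; elim/quotW => y.
rewrite -pi_seq_modD -(pi_seq_modZ a (x + y)) -(pi_seq_modZ a x).
by rewrite -(pi_seq_modZ a y) scalerDr pi_seq_modD.
Qed.
Let scaleDl p : {morph scale_mod^~ p : a b / a + b}.
Proof.
elim/quotW: p => x a b.
rewrite -(pi_seq_modZ (a + b) x) -(pi_seq_modZ a x) -(pi_seq_modZ b x).
by rewrite scalerDl pi_seq_modD.
Qed.
HB.instance Definition _ := GRing.Zmodule_isLmodule.Build R seq_mod_cst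
  scaleA scale1 scaleDr scaleDl.

End Quotient.

Section Realization.
Variables (R : realType) (n : nat) (P : affine_poset n).
Implicit Types (t : set int) (x : int -> R^o).
Local Notation Q := (seq_mod_cst R).

Definition period_shift : R := (n ^ (2 * n.+1))%:R.

Definition quasi_periodic : set (int -> R^o) :=
  [set x | forall i, x (i + n%:Z) = x i + period_shift].

Definition realization_space : set Q := [set \pi_Q x | x in quasi_periodic].

Definition alpha_seq t x : R :=
  \sum_(ij \in [set ij : int * int | [/\ t ij.1, t ij.2 & ap_cover P ij.1 ij.2]])
     (x ij.2 - x ij.1).

(* Independent of the choice of representative, see alpha_pi. *)
Definition alpha t (p : Q) : R := alpha_seq t (repr p).

Lemma alpha_pi t x : alpha t (\pi_Q x) = alpha_seq t x.
Proof.
have /eqP/seq_mod_cstP[r e] := reprK (\pi_Q x).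
apply: eq_fsbigr => ij _; rewrite [repr _]e !fctE /=.
by rewrite opprD addrACA subrr addr0.
Qed.

(* The size of t is only meaningful for finite t, such as proper tubes. *)
Definition tube_halfspace t : set Q :=
  [set p | (n ^ (2 * #|` fset_set t|))%:R <= alpha t p].

Definition cyclohedron_realization : set Q :=
  realization_space `&` \bigcap_(t in proper_tube P) tube_halfspace t.

End Realization.

Arguments cyclohedron_realization R {n} P.

(* Main.v *)
(** Suppose that x satisfies all the inequalities.  Then x increases along
    covers, and its values on a tight tube t spread over at most n^(2|t|).  If
    two tight tubes s and t are not nested but meet or satisfy s < t, then the
    convex hull of their union either contains two congruent elements or is a
    tube whose own inequality forces the values on their union to spread over
    more than n^(2|s|) + n^(2|t|).  So tight tubes which meet are nested, and
    s < t puts all values on s below all values on t: the tight tubes form a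
    tubing.

    Conversely, every tubing T, maximal or not, is exactly the set of tight
    tubes of some x.  Such an x is glued together recursively: a finite set of
    pairwise incongruent integers splits into a lower and an upper part such that
    no smaller tube of T meets both, and the gap between the parts is a free
    parameter, chosen either to make the inequality of the whole set tight or
    just to keep the tubes which cross it from being tight.

    Since exactness holds for T and for T with one tube removed, the functionals
    which are tight at a point have a dual basis.  This is all that is needed
    for the polyhedron to be simple with face poset the poset of tubings, and
    it makes counting the tubes of a maximal tubing unnecessary. *)
From HB Require Import structures.
Require Import Defs.
From mathcomp Require Import all_boot all_order all_algebra.
From mathcomp Require Import finmap generic_quotient zify ring lra.
From mathcomp Require Import all_classical all_reals.

Set Implicit Arguments.
Unset Strict Implicit.
Unset Printing Implicit Defensive.

Import Order.TTheory GRing.Theory Num.Theory.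

Local Open Scope classical_set_scope.
Local Open Scope ring_scope.
Local Open Scope quotient_scope.

(** * Affine posets *)

Lemma finite_int_range (a b : int) : finite_set [set k : int | a <= k <= b].
Proof.
apply: (@sub_finite_set _ _ ((fun m : nat => a + m%:Z) @` `I_(absz (b - a)%R).+1)).
  move=> k /= /andP[ak kb]; exists (absz (k - a)%R) => /=; lia.
exact/finite_image/finite_II.
Qed.

Lemma card_fset_set_lt (T : choiceType) (A B : set T) :
  finite_set B -> A `<=` B -> (exists x, B x /\ ~ A x) ->
  (#|` fset_set A| < #|` fset_set B|)%N.
Proof.
move=> finB AB [x [Bx Ax]]; have finA := sub_finite_set AB finB.
apply: fproper_ltn_card; rewrite fproperE; apply/andP; split.
  by apply/fsubsetP => y; rewrite !in_fset_set// !inE; exact: AB.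
apply/fsubsetPn; exists x; rewrite in_fset_set// ?inE//.
by apply/negP; rewrite inE.
Qed.

Section AffinePoset.
Variables (n : nat) (P : affine_poset n).
Implicit Types (i j k : int) (s t : set int).

Lemma ap_shift i j k : P (i + k * n%:Z) (j + k * n%:Z) = P i j.
Proof.
have shN (m : nat) a b : P (a + m%:Z * n%:Z) (b + m%:Z * n%:Z) = P a b.
  elim: m => [|m IH]; first by rewrite !mul0r !addr0.
  by rewrite -IH [in RHS]ap_le_shift intS; congr (P _ _); ring.
case: k => m; first exact: shN.
rewrite -(shN m.+1) NegzE; congr (P _ _); ring.
Qed.

Lemma ap_le_period i (k : nat) : P i (i + k%:Z * n%:Z).
Proof.
elim: k => [|k IH]; first by rewrite mul0r addr0 ap_refl.
apply: ap_trans IH _; have := ap_le_addn P (i + k%:Z * n%:Z).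
by rewrite intS; congr (is_true (P _ _)); ring.
Qed.

Hypothesis n_gt0 : (0 < n)%N.

Lemma ap_far : exists B : nat, forall i j, i + B%:Z <= j -> P i j.
Proof.
have /choice[k kP] : forall ab : 'I_n * 'I_n, exists k : int,
    P (ab.1 : nat)%:Z ((ab.2 : nat)%:Z + k * n%:Z).
  by move=> ab; exact: ap_cofinal.
exists (n * (\max_ab `|k ab|).+2)%N => i j ij.
have n0 : n%:Z != 0 by lia.
have modP a : exists r : 'I_n, a = (r : nat)%:Z + (a %/ n%:Z)%Z * n%:Z.
  have r0 : 0 <= (a %% n%:Z)%Z by rewrite modz_ge0.
  have rn : (a %% n%:Z)%Z < n%:Z by rewrite ltz_pmod//; lia.
  have rn' : (`|(a %% n%:Z)%Z| < n)%N by lia.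
  exists (Ordinal rn') => /=; rewrite gez0_abs//.
  by rewrite addrC; exact: divz_eq.
have [a ia] := modP i; have [b jb] := modP j.
set qi := (i %/ n%:Z)%Z in ia; set qj := (j %/ n%:Z)%Z in jb.
rewrite ia -(ap_shift _ _ (- qi)).
have -> : (a : nat)%:Z + qi * n%:Z + - qi * n%:Z = (a : nat)%:Z by ring.
apply: ap_trans (kP (a, b)) _ => /=.
have kle : (`|k (a, b)| <= \max_ab `|k ab|)%N by exact: leq_bigmax.
set M := (\max_ab _)%N in kle ij.
have : (M%:Z + 1) * n%:Z <= (qj - qi) * n%:Z.
  have := ltn_ord a; have := ltn_ord b; nia.
rewrite ler_pM2r; last by lia.
move=> Mq; have [m mE] : exists m : nat, qj - qi = k (a, b) + m%:Z.
  by exists (absz (qj - qi - k (a, b))%R); lia.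
have -> : j + - qi * n%:Z = (b : nat)%:Z + k (a, b) * n%:Z + m%:Z * n%:Z.
  by rewrite jb -addrA -mulrDl mE; ring.
exact: ap_le_period.
Qed.

Lemma finite_interval i j : finite_set [set k | P i k && P k j].
Proof.
have [B BP] := ap_far.
apply: sub_finite_set (finite_int_range (i - B%:Z) (j + B%:Z)) => k /= /andP[ik kj].
apply/andP; split; rewrite leNgt; apply/negP => lt.
- have ki : P k i by apply: BP; lia.
  have := @ap_anti _ P i k; rewrite ik ki => /(_ isT); lia.
- have ki : P j k by apply: BP; lia.
  have := @ap_anti _ P j k; rewrite kj ki => /(_ isT); lia.
Qed.

Lemma ap_lt_le i j : ap_lt P i j -> P i j. Proof. by case/andP. Qed.

Lemma ap_lt_neq i j : ap_lt P i j -> i != j. Proof. by case/andP. Qed.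

Lemma ap_cover_lt i j : ap_cover P i j -> ap_lt P i j.
Proof. by case/andP. Qed.

Lemma ap_le_lt_trans i j k : P i j -> ap_lt P j k -> ap_lt P i k.
Proof.
move=> ij /andP[jk Pjk]; rewrite /ap_lt (ap_trans ij Pjk) andbT.
apply: contraNneq jk => ik; apply/eqP/(@ap_anti _ P).
by rewrite Pjk -ik ij.
Qed.

Lemma ap_lt_le_trans i j k : ap_lt P i j -> P j k -> ap_lt P i k.
Proof.
move=> /andP[ij Pij] jk; rewrite /ap_lt (ap_trans Pij jk) andbT.
apply: contraNneq ij => ik; apply/eqP/(@ap_anti _ P).
by rewrite Pij ik jk.
Qed.

Lemma ap_lt_trans i j k : ap_lt P i j -> ap_lt P j k -> ap_lt P i k.
Proof. by move=> ij /ap_lt_le; exact: ap_lt_le_trans. Qed.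

Lemma ap_ltxx i : ap_lt P i i = false. Proof. by rewrite /ap_lt eqxx. Qed.

Lemma ap_le_eqVlt i j : P i j -> i = j \/ ap_lt P i j.
Proof. by move=> ij; rewrite /ap_lt ij andbT; case: eqVneq; [left|right]. Qed.

Lemma ap_lt_asym i j : ap_lt P i j -> ~ ap_lt P j i.
Proof. by move=> ij ji; have := ap_lt_trans ij ji; rewrite ap_ltxx. Qed.

Lemma ap_lt_shift i j k : ap_lt P (i + k * n%:Z) (j + k * n%:Z) = ap_lt P i j.
Proof. by rewrite /ap_lt ap_shift (inj_eq (addIr _)). Qed.

Lemma ap_lt_period i (k : int) : 0 < k -> ap_lt P i (i + k * n%:Z).
Proof.
move=> k0; rewrite /ap_lt; apply/andP; split.
  by apply/eqP; nia.
have -> : k = (`|k|%N)%:Z by lia.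
exact: ap_le_period.
Qed.

Lemma ap_cover_shift i j k :
  ap_cover P (i + k * n%:Z) (j + k * n%:Z) = ap_cover P i j.
Proof.
rewrite /ap_cover ap_lt_shift; congr (_ && _).
apply/asboolP/asboolP => H l.
  by rewrite -(ap_lt_shift i l k) -(ap_lt_shift l j k).
have -> : l = (l - k * n%:Z) + k * n%:Z by ring.
by rewrite !ap_lt_shift.
Qed.

(* Intervals of an affine poset are finite, so every relation is a chain of
   covers. *)
Lemma ap_cover_ind (Q : int -> int -> Prop) :
  (forall i, Q i i) ->
  (forall i j k, P i j -> P j k -> Q i j -> Q j k -> Q i k) ->
  (forall i j, ap_cover P i j -> Q i j) -> forall i j, P i j -> Q i j.
Proof.
move=> Q0 Qt Qc i j Pij.
have [m] := ubnP #|` fset_set [set k | P i k && P k j]|.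
elim: m i j Pij => // m IH i j Pij ltm.
have [<-|lt] := ap_le_eqVlt Pij; first exact: Q0.
have [cov|] := boolP (ap_cover P i j); first exact: Qc.
rewrite /ap_cover lt /= => /asboolPn/existsNP[k /negP].
rewrite negbK => /andP[ik kj].
have ik' := ap_lt_le ik; have kj' := ap_lt_le kj.
apply: (Qt i k j) => //; apply: IH => //; rewrite -ltnS; apply: leq_trans ltm;
  rewrite ltnS; apply: card_fset_set_lt; try exact: finite_interval.
- by move=> l /= /andP[-> lk]; exact: ap_trans lk kj'.
- exists j; rewrite /= Pij ap_refl; split=> //= jk.
  by have := ap_le_lt_trans jk kj; rewrite ap_ltxx.
- by move=> l /= /andP[kl ->]; rewrite (ap_trans ik' kl).
- exists i; rewrite /= Pij ap_refl; split=> //; rewrite andbT => ki.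
  by have := ap_lt_le_trans ik ki; rewrite ap_ltxx.
Qed.

End AffinePoset.

Lemma card_ge2P (T : choiceType) (A : set T) :
  (`I_2 #<= A)%card <-> exists a b, [/\ A a, A b & a != b].
Proof.
split=> [A2|[a [b [Aa Ab ab]]]].
  have [a Aa] : A !=set0.
    apply/set0P/eqP => A0; move: A2; rewrite A0 => /card_le0P/seteqP[/(_ 0%N)].
    by move=> /(_ isT).
  apply: contrapT => H.
  have A1 : A `<=` [set a].
    by move=> b Ab; apply: contrapT => /eqP ba; apply: H; exists b, a.
  have := card_le_trans A2 (subset_card_le A1).
  by rewrite (card_le_eqr card_set1) card_le_II.
have card2 : ([set` [fset a; b]%fset] #= `I_2)%card.
  by apply/card_eq_fsetP; rewrite cardfs2 ab.
rewrite -(card_le_eql card2); apply: subset_card_le => k /=.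
by rewrite !inE => /orP[]/eqP->.
Qed.

Section Hasse.
Variables (n : nat) (P : affine_poset n).
Hypothesis n_gt0 : (0 < n)%N.
Implicit Types (i j k : int) (s t : set int).

Lemma hasse_adj_sym i j : hasse_adj P i j = hasse_adj P j i.
Proof. exact: orbC. Qed.

Definition hasse_link t i j := exists p : seq int,
  [/\ path (hasse_adj P) i p, last i p = j & forall k, k \in p -> t k].

Lemma hasse_link_refl t i : hasse_link t i i. Proof. by exists [::]. Qed.

Lemma hasse_link_trans t i j k :
  hasse_link t i j -> hasse_link t j k -> hasse_link t i k.
Proof.
move=> [p [ip pj pt]] [q [jq qk qt]]; exists (p ++ q); split.
- by rewrite cat_path ip pj.
- by rewrite last_cat pj.
- by move=> l; rewrite mem_cat => /orP[/pt|/qt].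
Qed.

Lemma hasse_link_sym t i j : t i -> hasse_link t i j -> hasse_link t j i.
Proof.
move=> ti [p [ip pj pt]]; exists (rev (belast i p)); split.
- rewrite -pj rev_path; apply: sub_path ip => a b.
  by rewrite /= hasse_adj_sym.
- by case: p {ip pt} pj => [/= <-//|a p _] /=; rewrite rev_cons last_rcons.
- move=> k; rewrite mem_rev => /mem_belast.
  by rewrite inE => /orP[/eqP->//|/pt].
Qed.

Lemma hasse_link_sub s t i j : s `<=` t -> hasse_link s i j -> hasse_link t i j.
Proof. by move=> st [p [ip pj pt]]; exists p; split=> // k /pt/st. Qed.

Lemma ap_le_link i j : P i j -> hasse_link [set k | P i k && P k j] i j.
Proof.
apply: (ap_cover_ind n_gt0
  (Q := fun a b => hasse_link [set k | P a k && P k b] a b)).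
- by move=> k; exact: hasse_link_refl.
- move=> a b c ab bc lab lbc; apply: (@hasse_link_trans _ _ b).
    by apply: hasse_link_sub lab => k /andP[ak kb]; rewrite /= ak (ap_trans kb bc).
  by apply: hasse_link_sub lbc => k /andP[bk kc]; rewrite /= kc (ap_trans ab bk).
- move=> a b ab; exists [:: b]; split=> //=; first by rewrite /hasse_adj ab.
  by move=> k; rewrite inE => /eqP->; rewrite (ap_lt_le (ap_cover_lt ab)) ap_refl.
Qed.

Lemma connected_cross t (Q : pred int) i j : connected_in_hasse P t ->
  t i -> t j -> Q i -> ~~ Q j ->
  exists a b, [/\ t a, t b, Q a, ~~ Q b & hasse_adj P a b].
Proof.
move=> tc ti tj Qi Qj; have [p [ip pj pt]] := tc _ _ ti tj.
elim: p i ti Qi ip pj pt => [|k p IH] i ti Qi /=.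
  by move=> _ ij; move: Qj; rewrite -ij Qi.
move=> /andP[ik kp] pj pt.
have tk : t k by apply: pt; rewrite inE eqxx.
have [Qk|Qk] := boolP (Q k); last by exists i, k.
by apply: (IH k) => // l lp; apply: pt; rewrite inE lp orbT.
Qed.

Lemma hasse_adj_shift i j k :
  hasse_adj P (i + k * n%:Z) (j + k * n%:Z) = hasse_adj P i j.
Proof. by rewrite /hasse_adj !ap_cover_shift. Qed.

Lemma shift_setP t k i : shift_set n t k i <-> t (i - k * n%:Z).
Proof.
split=> [[j tj <-]|ti]; first by rewrite addrK.
by exists (i - k * n%:Z) => //; rewrite subrK.
Qed.

Lemma shift_setE t k i : shift_set n t k i = t (i - k * n%:Z).
Proof. exact/propext/shift_setP. Qed.

Lemma shift_set0 t : shift_set n t 0 = t.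
Proof. by apply/seteqP; split=> i; rewrite shift_setE mul0r subr0. Qed.

Lemma shift_setD t k l : shift_set n (shift_set n t k) l = shift_set n t (k + l).
Proof.
apply/seteqP; split=> i; rewrite !shift_setE; congr t; ring.
Qed.

Lemma shift_setK t k : shift_set n (shift_set n t k) (- k) = t.
Proof. by rewrite shift_setD subrr shift_set0. Qed.

Lemma shift_setNK t k : shift_set n (shift_set n t (- k)) k = t.
Proof. by rewrite shift_setD addNr shift_set0. Qed.

Lemma proper_tube_shift t k : proper_tube P t -> proper_tube P (shift_set n t k).
Proof.
move=> [[tc tv t2 t3] tT]; split; last first.
  move=> sT; apply: tT; rewrite -(shift_setK t k) sT; apply/seteqP; split=> // i _.
  by rewrite shift_setE.
split.
- move=> i j /shift_setP ti /shift_setP tj; have [p [ip pj pt]] := tc _ _ ti tj.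
  exists (map (fun a => a + k * n%:Z) p); split.
  + rewrite -[i in path _ i](subrK (k * n%:Z)).
    rewrite (path_map (f := fun a => a + k * n%:Z)).
    by apply: sub_path ip => a b /=; rewrite hasse_adj_shift.
  + rewrite -[i in last i](subrK (k * n%:Z)).
    by rewrite (last_map (fun a => a + k * n%:Z)) pj subrK.
  + by move=> l /mapP[a /pt ta ->]; apply/shift_setP; rewrite addrK.
- move=> a b c /shift_setP ta /shift_setP tc' ab bc; apply/shift_setP.
  by apply: tv ta tc' _ _; rewrite -mulNr ap_shift.
- have [a [b [ta tb ab]]] := (card_ge2P t).1 t2; apply/card_ge2P.
  exists (a + k * n%:Z), (b + k * n%:Z); rewrite !shift_setE !addrK; split=> //.
  by rewrite (inj_eq (addIr _)).
- right => i j /shift_setP ti /shift_setP tj ij; apply: (addIr (- (k * n%:Z))).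
  case: t3 => [/tT//|t3]; apply: t3 => //.
  by apply/eqP; rewrite eqz_modDr; apply/eqP.
Qed.

End Hasse.

(** * Tubes and edge sums *)

Section Tubes.
Variables (n : nat) (P : affine_poset n).
Hypothesis n_gt0 : (0 < n)%N.
Implicit Types (i j k : int) (s t : set int).

Definition mod_inj t := forall i j, t i -> t j -> (i = j %[mod n%:Z])%Z -> i = j.

Lemma proper_tube_mod_inj t : proper_tube P t -> mod_inj t.
Proof. by move=> [[_ _ _ []]]. Qed.

Lemma mod_inj_period t i k : mod_inj t -> t i -> t (i + k * n%:Z) -> k = 0.
Proof.
move=> ti_inj ti tk; have := ti_inj _ _ ti tk; rewrite addrC modzMDl => /(_ erefl).
nia.
Qed.

Lemma mod_inj_setT t : mod_inj t -> t <> setT.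
Proof.
move=> tI tT; have := @mod_inj_period _ 0 1 tI; rewrite tT => /(_ I I); lia.
Qed.

Lemma proper_tube_neq0 t : proper_tube P t -> t !=set0.
Proof. by move=> [[_ _ /card_ge2P[a [b [ta _ _]]] _] _]; exists a. Qed.

Lemma proper_tube_bounded : exists B : int, forall t i j, proper_tube P t ->
  t i -> t j -> j < i + B.
Proof.
have [B BP] := ap_far P n_gt0.
exists (n%:Z + B%:Z) => t i j tP ti tj; have tI := proper_tube_mod_inj tP.
case: tP => [[_ tv _ _] _]; rewrite addrA ltNge; apply/negP => ij.
have tn := tv _ _ _ ti tj (ap_le_addn P i) (BP _ _ ij).
by have := @mod_inj_period _ i 1 tI ti; rewrite mul1r => /(_ tn).
Qed.

Lemma finite_proper_tube t : proper_tube P t -> finite_set t.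
Proof.
move=> tP; have [a ta] := proper_tube_neq0 tP; have [B tB] := proper_tube_bounded.
apply: sub_finite_set (finite_int_range (a - B) (a + B)) => i ti /=.
have := tB _ _ _ tP ta ti; have := tB _ _ _ tP ti ta; lia.
Qed.

Lemma card_mod_inj (J : {fset int}) : mod_inj [set` J] -> (#|` J| <= n)%N.
Proof.
move=> JI; pose f i := absz (i %% n%:Z)%Z.
have r0 i : 0 <= (i %% n%:Z)%Z by rewrite modz_ge0; lia.
have rn i : (i %% n%:Z)%Z < n%:Z by rewrite ltz_pmod; lia.
rewrite -(size_map f) -[leqRHS](size_iota 0); apply: uniq_leq_size.
  rewrite map_inj_in_uniq ?fset_uniq// => i j iJ jJ; rewrite /f => fij.
  by apply: JI => //; have := r0 i; have := r0 j; lia.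
by move=> _ /mapP[i iJ ->]; rewrite mem_iota /f; have := r0 i; have := rn i; lia.
Qed.

Lemma card_proper_tube t : proper_tube P t -> (1 < #|` fset_set t| <= n)%N.
Proof.
move=> tP; have tf := finite_proper_tube tP; apply/andP; split.
  by case: tP => [[_ _ t2 _] _]; exact: leq_card_fset_set.
by apply: card_mod_inj; rewrite fset_setK//; exact: proper_tube_mod_inj.
Qed.

Lemma card_shift_set t k : proper_tube P t ->
  #|` fset_set (shift_set n t k)| = #|` fset_set t|.
Proof.
move=> /finite_proper_tube tf; rewrite /shift_set fset_set_image//.
by rewrite card_imfset//= => i j /addIr.
Qed.

Lemma cover_proper_tube i j : ap_cover P i j -> (i != j %[mod n%:Z])%Z ->
  proper_tube P [set i; j].
Proof.
move=> ij ijn; have lij := ap_cover_lt ij.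
have tI : mod_inj [set i; j].
  move=> a b /= [->|->] [->|->]// e; move/eqP: ijn; first by rewrite e.
  by rewrite -e.
split; last exact: mod_inj_setT.
split; last by right.
- have lk : hasse_link P [set i; j] i j.
    exists [:: j]; split=> //=; first by rewrite /hasse_adj ij.
    by move=> k; rewrite inE => /eqP->; right.
  move=> a b /= [->|->] [->|->].
  + exact: hasse_link_refl.
  + exact: lk.
  + by apply: hasse_link_sym lk; left.
  + exact: hasse_link_refl.
- move=> a b c /= [->|->] [->|->] ab bc.
  + by left; apply: (@ap_anti _ P); rewrite ab bc.
  + have [ib|ib] := ap_le_eqVlt ab; first by left.
    have [bj|bj] := ap_le_eqVlt bc; first by right.
    by case/andP: ij => _ /asboolP/(_ b); rewrite ib bj.
  + by case: (ap_lt_asym lij); have := ap_le_lt_trans (ap_trans ab bc) lij;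
       rewrite ap_ltxx.
  + by right; apply: (@ap_anti _ P); rewrite ab bc.
- by apply/card_ge2P; exists i, j; split; [left|right|exact: ap_lt_neq lij].
Qed.

End Tubes.

Lemma big_fsetU_disj (R : nmodType) (T : choiceType) (A B : {fset T}) (F : T -> R) :
  [disjoint A & B]%fset ->
  \sum_(i <- (A `|` B)%fset) F i = \sum_(i <- A) F i + \sum_(i <- B) F i.
Proof.
move=> AB; rewrite -big_cat; apply: perm_big; apply: uniq_perm.
- exact: fset_uniq.
- rewrite cat_uniq !fset_uniq andbT /=; apply/hasPn => x xB.
  by apply/negP => xA; move/fdisjointP: AB => /(_ _ xA); rewrite xB.
- by move=> x; rewrite mem_cat inE.
Qed.

Section EdgeSums.
Variables (R : realType) (n : nat) (P : affine_poset n).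
Hypothesis n_gt0 : (0 < n)%N.
Implicit Types (i j k : int) (s t : set int) (x : int -> R^o) (K : {fset int}).

Definition edge x i j : R := if ap_cover P i j then x j - x i else 0.

Definition cross x (A B : {fset int}) : R := \sum_(i <- A) \sum_(j <- B) edge x i j.

Lemma alpha_seq_cross t x : finite_set t ->
  alpha_seq P t x = cross x (fset_set t) (fset_set t).
Proof.
move=> tf; rewrite /cross -fsbig_finite//.
under eq_fsbigr do rewrite -fsbig_finite//.
rewrite pair_fsbig// /alpha_seq.
rewrite (_ : [set ij | _] = (t `*` t) `&` [set ij | ap_cover P ij.1 ij.2]).
  rewrite fsbig_mkcondr; apply: eq_fsbigr => ij _; rewrite /edge.
  by rewrite mem_setE.
by apply/seteqP; split=> ij /=; [case|case=> -[]].
Qed.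

Lemma crossUl x A B C : [disjoint A & B]%fset ->
  cross x (A `|` B)%fset C = cross x A C + cross x B C.
Proof. exact: big_fsetU_disj. Qed.

Lemma crossUr x A B C : [disjoint A & B]%fset ->
  cross x C (A `|` B)%fset = cross x C A + cross x C B.
Proof.
move=> AB; rewrite /cross -big_split/=; apply: eq_bigr => i _.
exact: big_fsetU_disj.
Qed.

Lemma edgeD x y i j : edge (x + y) i j = edge x i j + edge y i j.
Proof.
rewrite /edge; case: ifP => _; last by rewrite addr0.
by rewrite !fctE opprD addrACA.
Qed.

Lemma edgeZ (a : R) x i j : edge (a *: x) i j = a * edge x i j.
Proof.
by rewrite /edge; case: ifP => _; rewrite ?mulr0// mulrBr.
Qed.

Lemma alpha_seqD t x y : finite_set t ->
  alpha_seq P t (x + y) = alpha_seq P t x + alpha_seq P t y.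
Proof.
move=> tf; rewrite !alpha_seq_cross// -big_split; apply: eq_bigr => i _ /=.
by rewrite -big_split; apply: eq_bigr => j _ /=; exact: edgeD.
Qed.

Lemma alpha_seqZ t (a : R) x : finite_set t ->
  alpha_seq P t (a *: x) = a * alpha_seq P t x.
Proof.
move=> tf; rewrite !alpha_seq_cross// /cross mulr_sumr; apply: eq_bigr => i _ /=.
by rewrite mulr_sumr; apply: eq_bigr => j _ /=; exact: edgeZ.
Qed.

Lemma eq_alpha_seq t x y (r : R) : finite_set t -> (forall i, t i -> y i = x i + r) ->
  alpha_seq P t y = alpha_seq P t x.
Proof.
move=> tf xy; rewrite !alpha_seq_cross// /cross.
apply: eq_big_seq => i; rewrite in_fset_set// inE => ti.
apply: eq_big_seq => j; rewrite in_fset_set// inE => tj.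
by rewrite /edge; case: ifP => // _; rewrite !xy// opprD addrACA subrr addr0.
Qed.

Lemma alpha_seq_shift t k x y (r : R) : finite_set t ->
  (forall i, t i -> y (i + k * n%:Z) = x i + r) ->
  alpha_seq P (shift_set n t k) y = alpha_seq P t x.
Proof.
move=> tf xy; have sf : finite_set (shift_set n t k) by exact: finite_image.
rewrite !alpha_seq_cross// /cross /shift_set fset_set_image//.
have si : {in fset_set t &, injective (fun i => i + k * n%:Z)}.
  by move=> i j _ _ /addIr.
rewrite big_imfset//=; apply: eq_big_seq => i; rewrite in_fset_set// inE => ti.
rewrite big_imfset//=; apply: eq_big_seq => j; rewrite in_fset_set// inE => tj.
rewrite /edge ap_cover_shift; case: ifP => // _.
by rewrite !xy// opprD addrACA subrr addr0.
Qed.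

Lemma cross_ge_edge x A B i j :
  (forall a b, a \in A -> b \in B -> 0 <= edge x a b) -> i \in A -> j \in B ->
  edge x i j <= cross x A B.
Proof.
move=> x0 iA jB; rewrite /cross (big_fsetD1 i)//= (big_fsetD1 j)//=.
rewrite -addrA lerDl addr_ge0//.
  by rewrite big_seq sumr_ge0// => b /fsetD1P[_ bB]; exact: x0.
rewrite big_seq sumr_ge0// => a /fsetD1P[_ aA].
by rewrite big_seq sumr_ge0// => b; exact: x0.
Qed.

Lemma cross_ge0 x A B :
  (forall a b, a \in A -> b \in B -> 0 <= edge x a b) -> 0 <= cross x A B.
Proof.
move=> x0; rewrite /cross big_seq sumr_ge0// => a aA.
by rewrite big_seq sumr_ge0// => b; exact: x0.
Qed.

Lemma edge_xx x i : edge x i i = 0.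
Proof. by rewrite /edge subrr if_same. Qed.

Lemma path_le_cross K x i p : (forall a b, 0 <= edge x a b) ->
  path (hasse_adj P) i p -> uniq (i :: p) -> {subset i :: p <= K} ->
  `|x (last i p) - x i| <= cross x K K.
Proof.
move=> x0; elim: p i K => [|j p IH] i K /=.
  by rewrite subrr normr0 => *; exact: cross_ge0.
move=> /andP[ij jp] /andP[ip up] pK.
have iK : i \in K by apply: pK; rewrite inE eqxx.
have {}IH : `|x (last j p) - x j| <= cross x (K `\ i)%fset (K `\ i)%fset.
  apply: IH => // k kp; have kK : k \in K by apply: pK; rewrite inE kp orbT.
  rewrite in_fsetD1 kK andbT.
  by apply: contraNneq ip => <-.
have -> : x (last j p) - x i = x (last j p) - x j + (x j - x i) by rewrite subrKA.
apply: le_trans (ler_normD _ _) _.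
have KE : K = ([fset i] `|` K `\ i)%fset by rewrite fsetD1K.
have dis : [disjoint [fset i] & K `\ i]%fset.
  by rewrite fdisjoint1X in_fsetD1 eqxx.
rewrite [in leRHS]KE crossUl// !crossUr// addrC -addrA.
have -> : cross x [fset i]%fset [fset i]%fset = 0.
  by rewrite /cross !big_seq_fset1 edge_xx.
rewrite add0r addrA lerD//.
have jK : j \in (K `\ i)%fset.
  have jK : j \in K by apply: pK; rewrite !inE eqxx orbT.
  rewrite in_fsetD1 jK andbT.
  by apply: contraNneq ip => ->; rewrite inE eqxx.
have [E1 E2] : edge x i j <= cross x [fset i]%fset (K `\ i)%fset /\
    edge x j i <= cross x (K `\ i)%fset [fset i]%fset.
  by split; apply: cross_ge_edge => //; rewrite inE.
have [e1 e2] := (x0 i j, x0 j i).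
apply: le_trans (lerD E1 E2).
case/orP: ij => ij; move: e1 e2; rewrite /edge ij => e1 e2.
  by rewrite ger0_norm// lerDl.
by rewrite distrC ger0_norm// lerDr.
Qed.

Lemma diff_le_alpha t x i j : proper_tube P t -> (forall a b, 0 <= edge x a b) ->
  t i -> t j -> `|x j - x i| <= alpha_seq P t x.
Proof.
move=> tP x0 ti tj; have tf := finite_proper_tube n_gt0 tP.
have [[tc _ _ _] _] := tP; have [p [ip pj pt]] := tc _ _ ti tj.
rewrite alpha_seq_cross// -pj; case/shortenP: ip => q iq uq pq.
apply: path_le_cross => // k; rewrite in_fset_set// !inE => /orP[/eqP->//|/pq/pt//].
Qed.

End EdgeSums.

(** * Tight tubes form a tubing *)

Lemma ltr_of_gap (R : realDomainType) (a b u v i j : R) :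
  i - u <= a -> v - j <= b -> a + b < v - u -> i < j.
Proof. by lra. Qed.

Section TightTubes.
Variables (R : realType) (n : nat) (P : affine_poset n).
Hypothesis n_gt0 : (0 < n)%N.
Implicit Types (i j k : int) (s t : set int) (x : int -> R^o) (K : {fset int}).

Definition tube_bound t : R := (n ^ (2 * #|` fset_set t|))%:R.

Lemma double_cross_le K x (D : R) : 0 <= D ->
  (forall i j, i \in K -> j \in K -> x j - x i <= D) ->
  cross P x K K *+ 2 <= (#|` K| * (#|` K|).-1)%:R * D.
Proof.
move=> D0 xD; rewrite mulr2n {2}/cross exchange_big -big_split /=.
have sum_const (s : seq int) (c : R) : \sum_(i <- s) c = (size s)%:R * c.
  by rewrite big_tnth sumr_const card_ord mulr_natl.
rewrite natrM -mulrA -sum_const big_seq [leRHS]big_seq; apply: ler_sum => i iK.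
rewrite -big_split /= (big_fsetD1 i)//= edge_xx addr0 add0r.
have -> : (#|` K|).-1 = size (K `\ i)%fset by rewrite (cardfsD1 i K) iK.
rewrite -sum_const big_seq [leRHS]big_seq; apply: ler_sum => j /fsetD1P[_ jK].
rewrite /edge; case: ifP => [ij|_]; last by case: ifP => _; rewrite add0r//; exact: xD.
have /negbTE -> : ~~ ap_cover P j i.
  by apply/negP => /ap_cover_lt; exact: ap_lt_asym (ap_cover_lt ij).
by rewrite addr0; exact: xD.
Qed.

Lemma alpha_seq_pair x i j : ap_cover P i j -> alpha_seq P [set i; j] x = x j - x i.
Proof.
move=> ij; have ji : ap_cover P j i = false.
  by apply/negP => /ap_cover_lt; exact: ap_lt_asym (ap_cover_lt ij).
rewrite /alpha_seq (_ : [set ij | _] = [set (i, j)]) ?fsbig_set1//.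
apply/seteqP; split=> [[a b]|_ ->] /=; last by split=> //; [left|right].
have ii k : ap_cover P k k = false.
  by apply/negP => /ap_cover_lt; rewrite ap_ltxx.
by move=> [[->|->] [->|->]]; rewrite ?ii ?ji.
Qed.

Variable x : int -> R^o.
Hypothesis xq : quasi_periodic n x.
Hypothesis xA : forall t, proper_tube P t -> tube_bound t <= alpha_seq P t x.

Local Notation c := (period_shift R n).

Lemma period_shift_gt0 : 0 < c.
Proof. by rewrite ltr0n expn_gt0 n_gt0. Qed.

Lemma tube_bound_gt0 t : 0 < tube_bound t.
Proof. by rewrite ltr0n expn_gt0 n_gt0. Qed.

Lemma qp_shift i k : x (i + k * n%:Z) = x i + k%:~R * c.
Proof.
have shN (m : nat) j : x (j + m%:Z * n%:Z) = x j + m%:R * c.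
  elim: m => [|m IH]; first by rewrite !mul0r !addr0.
  have -> : j + m.+1%:Z * n%:Z = j + m%:Z * n%:Z + n%:Z by rewrite intS; ring.
  by rewrite xq IH -natr1 mulrDl mul1r addrA.
case: k => m; first exact: shN.
rewrite [X in _ = x X + _](_ : i = i + Negz m * n%:Z + m.+1%:Z * n%:Z).
  by rewrite shN NegzE mulrNz -pmulrn; ring.
by rewrite NegzE; ring.
Qed.

Lemma mod_eq_shift i j : (i = j %[mod n%:Z])%Z -> exists k, j = i + k * n%:Z.
Proof.
move=> /eqP; rewrite eqz_mod_dvd => /dvdzP[q e]; exists (- q).
by rewrite mulNr -e opprB subrKC.
Qed.

Lemma qp_cover i j : ap_cover P i j -> x i < x j.
Proof.
move=> ij; have lij := ap_cover_lt ij.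
have [/eqP ijn|ijn] := boolP (i == j %[mod n%:Z])%Z.
  have [k jE] := mod_eq_shift ijn; rewrite jE qp_shift ltrDl.
  have k0 : 0 < k.
    rewrite ltNge; apply/negP; rewrite le_eqVlt => /orP[/eqP k0|k0].
      by move: lij; rewrite jE k0 mul0r addr0 ap_ltxx.
    have : ap_lt P j (j + - k * n%:Z) by apply: ap_lt_period => //; lia.
    rewrite [X in ap_lt P j X](_ : _ = i); first exact: ap_lt_asym.
    by rewrite jE; ring.
  by rewrite mulr_gt0 ?period_shift_gt0// ltr0z.
have /xA := cover_proper_tube n_gt0 ij ijn; rewrite alpha_seq_pair//.
by rewrite -subr_gt0; apply: lt_le_trans; exact: tube_bound_gt0.
Qed.

Lemma qp_edge_ge0 i j : 0 <= edge P x i j.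
Proof. by rewrite /edge; case: ifP => // /qp_cover; rewrite subr_ge0 => /ltW. Qed.

Lemma qp_le i j : P i j -> x i <= x j.
Proof.
apply: (ap_cover_ind n_gt0 (Q := fun i j => x i <= x j)) => //.
- by move=> a b d _ _; exact: le_trans.
- by move=> a b /qp_cover/ltW.
Qed.

Lemma tight_diff t i j : proper_tube P t -> alpha_seq P t x = tube_bound t ->
  t i -> t j -> x j - x i <= tube_bound t.
Proof.
move=> tP <- ti tj; apply: le_trans (ler_norm _) _.
by apply: diff_le_alpha => //; exact: qp_edge_ge0.
Qed.

(* Otherwise the convex hull of the union would be a tube which is too small to
   be compatible with its own inequality. *)
Lemma tight_tubes_separated s t : proper_tube P s -> proper_tube P t ->
  alpha_seq P s x = tube_bound s -> alpha_seq P t x = tube_bound t ->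
  ~ nested s t ->
  (s `&` t !=set0 \/ exists a b, [/\ s a, t b & ap_lt P a b]) ->
  exists u v, [/\ (s `|` t) u, (s `|` t) v & tube_bound s + tube_bound t < x v - x u].
Proof.
move=> sP tP sx tx nst meet; apply: contrapT => H.
set D := _ + _ in H; set S := s `|` t in H.
have {}H u v : S u -> S v -> x v - x u <= D.
  by move=> Su Sv; rewrite leNgt; apply/negP => lt; apply: H; exists u, v.
have /andP[s2 sn] := card_proper_tube n_gt0 sP.
have /andP[t2 tn] := card_proper_tube n_gt0 tP.
have n2 : (1 < n)%N by exact: leq_trans sn.
have n2R : 2 <= n%:R :> R by rewrite (ler_nat R 2).
have boundM m u : (#|` fset_set u| <= m)%N -> tube_bound u <= n%:R ^+ (2 * m).
  by move=> um; rewrite /tube_bound natrX ler_weXn2l ?leq_mul2l// ler1n.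
have D0 : 0 <= D by rewrite addr_ge0// ltW// tube_bound_gt0.
have Dc : D < c.
  apply: (@le_lt_trans _ _ (n%:R ^+ (2 * n) *+ 2)).
    by rewrite mulr2n lerD// boundM.
  rewrite /period_shift natrX mulnS exprD -mulr_natl.
  rewrite ltr_pM2r ?exprn_gt0 ?(lt_le_trans _ n2R)//.
  by rewrite -natrX ltr_nat (@leq_trans (2 ^ 2))// leq_exp2r.
pose rho := [set z | exists a b, [/\ S a, S b, P a z & P z b]].
have Srho : S `<=` rho by move=> a Sa; exists a, a; rewrite ap_refl.
have rhoD z w : rho z -> rho w -> x w - x z <= D.
  move=> [a [_ [Sa _ az _]]] [_ [b [_ Sb _ wb]]].
  apply: le_trans (H _ _ Sa Sb); apply: lerB; exact: qp_le.
have rhoI : mod_inj n rho.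
  move=> z w rz rw zw; have [k wE] := mod_eq_shift zw.
  have := rhoD _ _ rz rw; have := rhoD _ _ rw rz.
  rewrite wE qp_shift addrAC subrr add0r opprD addrA subrr add0r => k1 k2.
  suff -> : k = 0 by rewrite mul0r addr0.
  have c0 := period_shift_gt0.
  have : (k%:~R : R) < 1 by rewrite -(ltr_pM2r c0) mul1r; apply: le_lt_trans Dc.
  have : - (k%:~R : R) < 1.
    by rewrite -(ltr_pM2r c0) mul1r mulNr; apply: le_lt_trans Dc.
  rewrite ltrNl -[-1]/((-1)%:~R) ltr_int ltrz1; lia.
have rhoV : ap_convex P rho.
  move=> z y w [a [_ [Sa _ az _]]] [_ [b [_ Sb _ wb]]] zy yw; exists a, b.
  by split=> //; [exact: ap_trans az zy|exact: ap_trans yw wb].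
have link_int z w : rho z -> rho w -> P z w -> hasse_link P rho z w.
  move=> rz rw zw; apply: hasse_link_sub (ap_le_link n_gt0 zw) => y /= /andP[].
  exact: rhoV.
have linkS a b : S a -> S b -> hasse_link P rho a b.
  have link1 u v : s u -> s v -> hasse_link P rho u v.
    move=> su sv; apply: (@hasse_link_sub _ _ s).
      by move=> y sy; apply: Srho; left.
    by case: sP => -[sc _ _ _] _; exact: sc.
  have link2 u v : t u -> t v -> hasse_link P rho u v.
    move=> tu tv; apply: (@hasse_link_sub _ _ t).
      by move=> y ty; apply: Srho; right.
    by case: tP => -[tc _ _ _] _; exact: tc.
  have [u [v [su tv uv vu]]] : exists u v, [/\ s u, t v, hasse_link P rho u v &
      hasse_link P rho v u].
    case: meet => [[u [su tu]]|[u [v [su tv uv]]]].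
      by exists u, u; split=> //; exact: hasse_link_refl.
    have ru : rho u by apply: Srho; left.
    have rv : rho v by apply: Srho; right.
    have l : hasse_link P rho u v by apply: link_int => //; exact: ap_lt_le.
    by exists u, v; split=> //; exact: hasse_link_sym l.
  move=> [sa|ta] [sb|tb].
  - exact: link1.
  - exact: hasse_link_trans (link1 _ _ sa su) (hasse_link_trans uv (link2 _ _ tv tb)).
  - exact: hasse_link_trans (link2 _ _ ta tv) (hasse_link_trans vu (link1 _ _ su sb)).
  - exact: link2.
have rhoP : proper_tube P rho.
  split; last exact: mod_inj_setT rhoI.
  split => //; last by right.
    move=> z w rz rw; have [a [_ [Sa _ az _]]] := rz.
    have [b [_ [Sb _ bw _]]] := rw.
    apply: hasse_link_trans (link_int _ _ (Srho _ Sb) rw bw).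
    apply: hasse_link_trans (linkS _ _ Sa Sb).
    apply: hasse_link_sym; first exact: Srho.
    exact: link_int (Srho _ Sa) rz az.
  case: sP => -[_ _ s2' _] _; apply: card_le_trans s2' _.
  by apply: subset_card_le => a sa; apply: Srho; left.
have rf := finite_proper_tube n_gt0 rhoP.
have /andP[r2 rn] := card_proper_tube n_gt0 rhoP.
set r := #|` fset_set rho| in r2 rn.
have sr : (#|` fset_set s| <= r.-1)%N.
  suff : (#|` fset_set s| < r)%N by case: (r).
  apply: card_fset_set_lt => //; first by move=> a sa; apply: Srho; left.
  apply: contrapT => K; apply: nst; right => a ta; apply: contrapT => sa.
  by apply: K; exists a; split=> //; apply: Srho; right.
have tr : (#|` fset_set t| <= r.-1)%N.
  suff : (#|` fset_set t| < r)%N by case: (r).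
  apply: card_fset_set_lt => //; first by move=> a ta; apply: Srho; right.
  apply: contrapT => K; apply: nst; left => a sa; apply: contrapT => ta.
  by apply: K; exists a; split=> //; apply: Srho; left.
have := xA rhoP; rewrite leNgt => /negP; apply.
rewrite -(@ltr_pMn2r _ 2)// alpha_seq_cross//.
have DM : D <= n%:R ^+ (2 * r.-1) *+ 2 by rewrite mulr2n lerD// boundM.
apply: (@le_lt_trans _ _ ((r * r.-1)%:R * D)).
  apply: double_cross_le => // i j; rewrite !in_fset_set// !inE; exact: rhoD.
apply: (@le_lt_trans _ _ ((r * r.-1)%:R * (n%:R ^+ (2 * r.-1) *+ 2))).
  by rewrite ler_wpM2l.
rewrite mulrnAr ltrMn2r /= /tube_bound -/r -natrX -natrM ltr_nat.
case: (r) r2 rn => // q _ qn; rewrite mulnS expnD ltn_pmul2r ?expn_gt0 ?n_gt0//=.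
by rewrite -mulnn; nia.
Qed.

Lemma tight_tubes_compatible s t : proper_tube P s -> proper_tube P t ->
  alpha_seq P s x = tube_bound s -> alpha_seq P t x = tube_bound t ->
  nested s t \/ disjoint_tubes s t.
Proof.
move=> sP tP sx tx; have [nst|nst] := pselect (nested s t); first by left.
right; apply: contrapT => /eqP/set0P[z [sz tz]].
have [|u [v [Su Sv]]] := tight_tubes_separated sP tP sx tx nst.
  by left; exists z.
apply/negP; rewrite -leNgt.
have ds p q := @tight_diff s p q sP sx; have dt p q := @tight_diff t p q tP tx.
case: Su Sv => [su|tu] [sv|tv].
- by apply: le_trans (ds _ _ su sv) _; rewrite lerDl ltW// tube_bound_gt0.
- by rewrite -(subrKA (x z)) addrC lerD// ?ds// dt.
- by rewrite -(subrKA (x z)) lerD// ?ds// dt.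
- by apply: le_trans (dt _ _ tu tv) _; rewrite lerDr ltW// tube_bound_gt0.
Qed.

Lemma tight_tubes_prec s t i j : proper_tube P s -> proper_tube P t ->
  alpha_seq P s x = tube_bound s -> alpha_seq P t x = tube_bound t ->
  tube_prec P s t -> s i -> t j -> x i < x j.
Proof.
move=> sP tP sx tx [dis [a [b [sa tb ab]]]] si tj.
have nst : ~ nested s t.
  move=> [st|ts].
    have : (s `&` t) a by split=> //; exact: st.
    by rewrite dis.
  have : (s `&` t) b by split=> //; exact: ts.
  by rewrite dis.
have [|u [v [Su Sv]]] := tight_tubes_separated sP tP sx tx nst.
  by right; exists a, b.
have ds p q := @tight_diff s p q sP sx; have dt p q := @tight_diff t p q tP tx.
have le_contra : x v - x u <= tube_bound s + tube_bound t ->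
    tube_bound s + tube_bound t < x v - x u -> x i < x j.
  by move=> le lt; have := le_lt_trans le lt; rewrite ltxx.
case: Su Sv => [su|tu] [sv|tv].
- apply: le_contra; apply: le_trans (ds _ _ su sv) _.
  by rewrite lerDl ltW// tube_bound_gt0.
- exact: ltr_of_gap (ds _ _ su si) (dt _ _ tj tv).
- apply: le_contra; rewrite -(subrKA (x a)) lerD ?ds//.
  apply: le_trans (dt _ _ tu tb); rewrite lerB// qp_le//; exact: ap_lt_le.
- apply: le_contra; apply: le_trans (dt _ _ tu tv) _.
  by rewrite lerDr ltW// tube_bound_gt0.
Qed.

Definition tight_tubes := [set t | proper_tube P t /\ alpha_seq P t x = tube_bound t].

Lemma alpha_seq_period t k : proper_tube P t ->
  alpha_seq P (shift_set n t k) x = alpha_seq P t x.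
Proof.
move=> tP; apply: alpha_seq_shift (finite_proper_tube n_gt0 tP) _ => i _.
exact: qp_shift.
Qed.

Lemma tight_tubing : proper_tubing P tight_tubes.
Proof.
split.
- by move=> t [].
- move=> t k [tP tx]; split; first exact: proper_tube_shift.
  by rewrite alpha_seq_period// tx /tube_bound (card_shift_set n_gt0 k tP).
- by move=> s t [sP sx] [tP tx]; exact: tight_tubes_compatible.
- move=> k t tT tt tk0.
  have /choice[z zt] : forall l, exists i, (l <= k)%N -> t l i.
    move=> l; have [lk|lk] := leqP l k; last by exists 0.
    by have [i ti] := proper_tube_neq0 (proj1 (tT l lk)); exists i.
  have zle l : (l <= k)%N -> x (z 0%N) <= x (z l).
    elim: l => // l IH lk; apply: le_trans (IH (ltnW lk)) _; apply: ltW.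
    have [P1 x1] := tT _ (ltnW lk); have [P2 x2] := tT _ lk.
    by apply: tight_tubes_prec P1 P2 x1 x2 (tt _ lk) _ _; apply: zt => //; exact: ltnW.
  have [P1 x1] := tT _ (leqnn k); have [P2 x2] := tT _ (leq0n k).
  have := tight_tubes_prec P1 P2 x1 x2 tk0 (zt _ (leqnn k)) (zt _ (leq0n k)).
  by rewrite ltNge zle.
Qed.

End TightTubes.

(** * Every tubing is realized *)

Lemma maximal_set_above (C : set (set int)) (m : nat) (t : set int) :
  (forall s, C s -> finite_set s /\ (#|` fset_set s| <= m)%N) -> C t ->
  exists s, [/\ C s, t `<=` s & forall r, C r -> s `<=` r -> r = s].
Proof.
move=> Cm; have [d] := ubnP (m - #|` fset_set t|).
elim: d t => // d IH t td Ct; have [tf tm] := Cm _ Ct.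
have [[r [Cr tr rt]]|H] := pselect (exists r, [/\ C r, t `<=` r & r <> t]).
  have [rf rm] := Cm _ Cr.
  have lt : (#|` fset_set t| < #|` fset_set r|)%N.
    apply: card_fset_set_lt => //; apply: contrapT => K; apply: rt.
    apply/seteqP; split=> // x rx; apply: contrapT => tx.
    by apply: K; exists x.
  have [|s [Cs rs smax]] := IH r _ Cr; first by lia.
  by exists s; split=> //; exact: subset_trans tr rs.
exists t; split=> // r Cr tr; apply: contrapT => rt; apply: H.
by exists r.
Qed.

Section SplitTubing.
Variables (n : nat) (P : affine_poset n).
Hypothesis n_gt0 : (0 < n)%N.
Implicit Types (i j k : int) (s t : set int) (J K : {fset int}).

Lemma ap_minimal K : K != fset0 ->
  exists2 z, z \in K & forall y, y \in K -> ~ ap_lt P y z.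
Proof.
have [m] := ubnP #|` K|; elim: m K => // m IH K Km /fset0Pn[z zK].
have [[y [yK yz]]|H] := pselect (exists y, y \in K /\ ap_lt P y z); last first.
  by exists z => // y yK yz; apply: H; exists y.
pose K' := [fset y in K | ap_lt P y z]%fset.
have [||w] := IH K'.
- rewrite -ltnS; apply: leq_trans Km; rewrite ltnS (cardfsD1 z K) zK ltnS.
  apply: fsubset_leq_card; apply/fsubsetP => w; rewrite !inE /= => /andP[-> wz].
  by rewrite andbT; exact: ap_lt_neq wz.
- by apply/fset0Pn; exists y; rewrite !inE /= yK yz.
rewrite !inE /= => /andP[wK wz] wmin; exists w => // v vK vw.
by apply: (wmin v) => //; rewrite !inE /= vK (ap_lt_trans vw wz).
Qed.

Variable T : set (set int).
Hypothesis TP : proper_tubing P T.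

Lemma tubing_tube t : T t -> proper_tube P t.
Proof. by case: TP => + _ _ _; exact. Qed.

Lemma tubing_shift t k : T t -> T (shift_set n t k).
Proof. by case: TP => _ + _ _; exact. Qed.

Lemma tubing_nested s t : T s -> T t -> nested s t \/ disjoint_tubes s t.
Proof. by case: TP => _ _ + _; exact. Qed.

Lemma tubing_bounded s : T s -> finite_set s /\ (#|` fset_set s| <= n)%N.
Proof.
move=> /tubing_tube sP; split; first exact: finite_proper_tube sP.
by have /andP[] := card_proper_tube n_gt0 sP.
Qed.

Lemma tubing_acyclic (l m : nat) (t : nat -> set int) : (l < m)%N ->
  (forall a, (l <= a < m)%N -> T (t a) /\ tube_prec P (t a) (t a.+1)) ->
  t l <> t m.
Proof.
move=> lm tT tlm; case: TP => _ _ _ /(_ (m.-1 - l)%N (fun a => t (l + a)%N)).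
have lmE : (l + (m.-1 - l))%N = m.-1 by lia.
rewrite lmE addn0 => K; apply: K.
- by move=> a am; apply: (proj1 (tT _ _)); lia.
- by move=> a am; rewrite addnS; apply: (proj2 (tT _ _)); lia.
- by rewrite tlm; have [|_] := tT m.-1; [lia|rewrite prednK//; lia].
Qed.

Lemma minimal_tube (B : set (set int)) J : B `<=` T ->
  (forall t, B t -> t `<=` [set` J]) ->
  (forall s t, B s -> B t -> s = t \/ disjoint_tubes s t) ->
  B !=set0 -> exists2 X, B X & forall Y, B Y -> ~ tube_prec P Y X.
Proof.
move=> BT BJ Bdis [X0 BX0].
pose chain m := `[< exists t : nat -> set int, (forall l, (l <= m)%N -> B (t l)) /\
  forall l, (l < m)%N -> tube_prec P (t l) (t l.+1) >].
have chain0 : exists m, chain m by exists 0%N; apply/asboolP; exists (fun=> X0).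
have chainJ m : chain m -> (m <= #|` J|)%N.
  move=> /asboolP[t [tB tt]].
  have dis a b : (a < b)%N -> (b <= m)%N -> t a `&` t b = set0.
    move=> ab bm; have [||tab|//] := Bdis (t a) (t b); try by apply: tB; lia.
    exfalso; apply: (tubing_acyclic ab) tab => d abd.
    by split; [apply/BT/tB|apply: tt]; lia.
  have /choice[z zt] : forall l, exists i, (l <= m)%N -> t l i.
    move=> l; have [lm|lm] := leqP l m; last by exists 0.
    by have [i ti] := proper_tube_neq0 (tubing_tube (BT _ (tB _ lm))); exists i.
  rewrite -[m](size_iota 0) -(size_map z); apply: uniq_leq_size.
    rewrite map_inj_in_uniq ?iota_uniq// => a b; rewrite !mem_iota => am bm zab.
    have [ab|ba|//] := ltngtP a b.
      have : (t a `&` t b) (z a) by split; [|rewrite zab]; apply: zt; lia.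
      by rewrite dis//; lia.
    have : (t b `&` t a) (z a) by split; [rewrite zab|]; apply: zt; lia.
    by rewrite dis//; lia.
  move=> _ /mapP[a + ->]; rewrite mem_iota => am.
  by apply: (BJ (t a)); [apply: tB|apply: zt]; lia.
case: (ex_maxnP chain0 chainJ) => m /asboolP[t [tB tt]] mmax.
exists (t 0%N); first exact: tB.
move=> Y BY Yt; suff /mmax : chain m.+1 by rewrite ltnn.
apply/asboolP; exists (fun l => if l is l'.+1 then t l' else Y); split.
  by case=> // l; exact: tB.
by case=> // l; exact: tt.
Qed.

Definition tubing_split J J1 J2 :=
  [/\ [/\ J1 != fset0, J2 != fset0, [disjoint J1 & J2]%fset & J = (J1 `|` J2)%fset],
      forall a b, a \in J1 -> b \in J2 -> ~ ap_lt P b a &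
      forall t, T t -> t `<=` [set` J] ->
        [\/ t = [set` J], t `<=` [set` J1] | t `<=` [set` J2] ]].

Lemma tubing_split_lower J J1 : J1 != fset0 -> (J1 `<` J)%fset ->
  (forall a b, a \in J1 -> b \in J -> b \notin J1 -> ~ ap_lt P b a) ->
  (forall t, T t -> t `<=` [set` J] -> t <> [set` J] ->
    t `<=` [set` J1] \/ forall a, t a -> a \notin J1) ->
  exists J2, tubing_split J J1 J2.
Proof.
move=> J10 /andP[J1J JJ1] low tT; exists (J `\` J1)%fset; split.
- split=> //; first by rewrite fsetD_eq0.
    by apply/fdisjointP => a aJ1; rewrite inE aJ1.
  by rewrite -[LHS](fsetID J1 J); congr (_ `|` _)%fset; exact/fsetIidPr.
- by move=> a b aJ1; rewrite inE => /andP[bJ1 bJ]; exact: low.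
- move=> t Tt tJ; have [tE|tE] := pselect (t = [set` J]); first exact: Or31.
  have [tJ1|tJ1] := tT _ Tt tJ tE; first exact: Or32.
  apply: Or33 => a ta /=; rewrite inE tJ1//; exact: tJ.
Qed.

Lemma tubing_split_minimal J z : (1 < #|` J|)%N -> z \in J ->
  (forall y, y \in J -> ~ ap_lt P y z) ->
  (forall t, T t -> t `<=` [set` J] -> t <> [set` J] -> ~ t z) ->
  exists J2, tubing_split J [fset z]%fset J2.
Proof.
move=> J2 zJ zmin zT; apply: tubing_split_lower.
- by apply/fset0Pn; exists z; rewrite inE.
- by rewrite fproperEcard fsub1set zJ cardfs1.
- by move=> a b; rewrite inE => /eqP-> bJ _; exact: zmin.
- move=> t Tt tJ tE; right => a ta; rewrite inE.
  by apply/eqP => az; apply: (zT _ Tt tJ tE); rewrite -az.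
Qed.

(* The first part is a minimal block of J, where the blocks are the maximal
   tubes of T properly inside J and the remaining singletons. *)
Lemma tubing_split_ex J : (1 < #|` J|)%N -> exists J1 J2, tubing_split J J1 J2.
Proof.
move=> J2.
pose C t := [/\ T t, t `<=` [set` J] & t <> [set` J]].
pose B t := C t /\ forall r, C r -> t `<=` r -> r = t.
have Bmax t : C t -> exists2 s, B s & t `<=` s.
  move=> Ct; have [|s [Cs ts smax]] := @maximal_set_above C n t _ Ct.
    by move=> s [/tubing_bounded].
  by exists s.
have [[X0 CX0]|noC] := pselect (exists t, C t); last first.
  have [|z zJ zmin] := @ap_minimal J; first by rewrite -cardfs_gt0; lia.
  exists [fset z]%fset; apply: tubing_split_minimal => // t Tt tJ tE _.
  by apply: noC; exists t.
have Bdis s t : B s -> B t -> s = t \/ disjoint_tubes s t.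
  move=> [Cs smax] [Ct tmax]; have [Ts _ _] := Cs; have [Tt _ _] := Ct.
  have [[st|ts]|] := tubing_nested Ts Tt; last by right.
    by left; apply/esym/smax.
  by left; exact: tmax.
have [||||X BX Xmin] := @minimal_tube B J.
- by move=> t [[]].
- by move=> t [[]].
- exact: Bdis.
- by have [X BX _] := Bmax _ CX0; exists X.
have [[TX XJ XE] _] := BX.
have XP := tubing_tube TX; have Xf := finite_proper_tube n_gt0 XP.
pose Z := [fset z in J | `[< ~ X z /\ exists2 x, X x & ap_lt P z x >]]%fset.
have [Z0|/ap_minimal[z]] := eqVneq Z fset0; last first.
  rewrite !inE /= => /andP[zJ /asboolP[Xz [x Xx zx]]] zmin.
  have zB t : T t -> t `<=` [set` J] -> t <> [set` J] -> ~ t z.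
    move=> Tt tJ tE tz; have [Y BY tY] := Bmax _ (And3 Tt tJ tE).
    have [YX|YX] := Bdis _ _ BY BX; first by apply: Xz; rewrite -YX; exact: tY.
    by apply: (Xmin _ BY); split=> //; exists z, x; split=> //; exact: tY.
  exists [fset z]%fset; apply: tubing_split_minimal => // y yJ yz.
  apply: (zmin y) => //.
  rewrite !inE /= yJ /=; apply/asboolP; split; last first.
    by exists x => //; exact: ap_lt_trans yz zx.
  move=> Xy; apply: Xz; case: XP => -[_ Xv _ _] _.
  exact: Xv Xy Xx (ap_lt_le yz) (ap_lt_le zx).
exists (fset_set X); apply: tubing_split_lower.
- have [x Xx] := proper_tube_neq0 XP.
  by apply/fset0Pn; exists x; rewrite in_fset_set// inE.
- rewrite fproperEneq; apply/andP; split.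
    by apply/eqP => XJ'; apply: XE; rewrite -XJ' fset_setK.
  by apply/fsubsetP => a; rewrite in_fset_set// inE; exact: XJ.
- move=> a b; rewrite !in_fset_set// !inE => Xa bJ /negP; rewrite inE => Xb ba.
  have : b \in Z by rewrite !inE /= bJ /=; apply/asboolP; split=> //; exists a.
  by rewrite Z0.
- move=> t Tt tJ tE; have [Y BY tY] := Bmax _ (And3 Tt tJ tE).
  have [YX|YX] := Bdis _ _ BY BX; [left|right] => a ta.
    by rewrite /= in_fset_set// inE -YX; exact: tY.
  rewrite in_fset_set//; apply/negP; rewrite inE => Xa.
  have : (Y `&` X) a by split=> //; exact: tY.
  by rewrite YX.
Qed.

End SplitTubing.

Section Realize.
Variables (R : realType) (n : nat) (P : affine_poset n).
Hypothesis n_gt0 : (0 < n)%N.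
Implicit Types (i j k : int) (s t : set int) (x y : int -> R^o) (J K : {fset int}).

Local Notation cross := (cross P).

Lemma crossD x y A B : cross (x + y) A B = cross x A B + cross y A B.
Proof.
by rewrite -big_split; apply: eq_bigr => i _; rewrite -big_split;
   apply: eq_bigr => j _; exact: edgeD.
Qed.

Lemma crossZ (a : R) x A B : cross (a *: x) A B = a * cross x A B.
Proof.
by rewrite mulr_sumr; apply: eq_bigr => i _; rewrite mulr_sumr;
   apply: eq_bigr => j _; exact: edgeZ.
Qed.

Lemma eq_cross x y (r : R) A B : (forall i, i \in A -> y i = x i + r) ->
  (forall i, i \in B -> y i = x i + r) -> cross y A B = cross x A B.
Proof.
move=> yA yB; apply: eq_big_seq => i iA; apply: eq_big_seq => j jB.
rewrite /edge; case: ifP => // _.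
by rewrite (yA _ iA) (yB _ jB) opprD addrACA subrr addr0.
Qed.

Lemma ler_cross x y A B :
  (forall i j, i \in A -> j \in B -> edge P x i j <= edge P y i j) ->
  cross x A B <= cross y A B.
Proof.
move=> xy; rewrite /cross big_seq [leRHS]big_seq; apply: ler_sum => i iA.
by rewrite big_seq [leRHS]big_seq; apply: ler_sum => j jB; exact: xy.
Qed.

Lemma cross_le_card x A B :
  (forall i j, i \in A -> j \in B -> edge P x i j <= 1) ->
  cross x A B <= (#|` A| * #|` B|)%:R.
Proof.
move=> x1.
have sum_le (s : seq int) (f : int -> R) (c : R) :
    (forall i, i \in s -> f i <= c) -> \sum_(i <- s) f i <= c *+ size s.
  move=> fc; apply: (@le_trans _ _ (\sum_(i <- s) c)).
    by rewrite big_seq [leRHS]big_seq; exact: ler_sum.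
  by rewrite big_tnth sumr_const card_ord.
rewrite mulnC natrM mulr_natr; apply: (sum_le) => i iA.
by apply: sum_le => j jB; exact: x1.
Qed.

Lemma cross_no_cover x A B : (forall a b, a \in A -> b \in B -> ~ ap_lt P a b) ->
  cross x A B = 0.
Proof.
move=> AB; rewrite /cross big_seq big1// => i iA; rewrite big_seq big1// => j jB.
by rewrite /edge; case: ifP => // /ap_cover_lt /AB; case.
Qed.

Lemma four_muln_le (s t m : nat) : (s + t <= m)%N -> (4 * (s * t) <= m ^ 2)%N.
Proof.
by move=> stm; apply: leq_trans (nat_AGM2 s t) _; rewrite leq_exp2r.
Qed.

Definition block_bound m : nat := if (1 < m)%N then (n ^ (2 * m))%N else 0%N.

Lemma block_boundD (s t : nat) : (0 < s)%N -> (0 < t)%N -> (s + t <= n)%N ->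
  (block_bound s + block_bound t <= n ^ (2 * (s + t).-1))%N /\
  (9 * (block_bound s + block_bound t) <= n ^ (2 * (s + t)))%N.
Proof.
move=> s0 t0 stn.
have sq m : (0 < m)%N -> (n ^ (2 * m))%N = (n ^ 2 * n ^ (2 * m.-1))%N.
  by case: m => // m _; rewrite mulnS expnD.
have main : (block_bound s + block_bound t <= n ^ (2 * (s + t).-1))%N.
  rewrite /block_bound; case: ifPn => [s1|]; case: ifPn => [t1|].
  - have E : (n ^ (2 * (s + t).-1))%N = (n ^ 2 * n ^ (2 * (s + t).-2))%N.
      by apply: sq; lia.
    have Es : (n ^ (2 * s) <= n ^ (2 * (s + t).-2))%N by rewrite leq_pexp2l; lia.
    have Et : (n ^ (2 * t) <= n ^ (2 * (s + t).-2))%N by rewrite leq_pexp2l; lia.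
    rewrite E; apply: leq_trans (leq_add Es Et) _.
    by rewrite addnn -mul2n leq_mul2r -mulnn; apply/orP; right; nia.
  - by move=> t1; rewrite addn0 leq_pexp2l//; lia.
  - by move=> s1; rewrite add0n leq_pexp2l//; lia.
  - by [].
split=> //; have [n3|n3] := leqP 3 n; last first.
  rewrite /block_bound; have /negbTE -> : ~~ (1 < s)%N by lia.
  by have /negbTE -> : ~~ (1 < t)%N by lia.
rewrite [leqRHS]sq; last by lia.
by apply: leq_mul => //; rewrite (leq_exp2r 3 n (e := 2)).
Qed.

Lemma block_bound_facts (X M U nn k : R) (a e : R) :
  0 < M -> X = nn * M -> 1 <= k -> 4 * k <= nn -> 0 <= U -> U <= M -> 9 * U <= X ->
  0 <= a -> a <= 7 / 20 * nn * U -> 0 <= e -> e <= 5 / 4 * U * k ->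
  M < (X - a - e) / k /\ (X - a - e) / k <= X.
Proof.
move=> M0 XE k1 kn U0 UM UX a0 aU e0 eU; have k0 : 0 < k by lra.
have nU : nn * U <= X by rewrite XE ler_wpM2l//; lra.
have kU : U * k <= M * k by rewrite ler_wpM2r//; lra.
have kM : 4 * (M * k) <= X by rewrite XE; have := ler_wpM2l (ltW M0) kn; lra.
have X0 : 0 < X by rewrite XE mulr_gt0//; lra.
split; first by rewrite ltr_pdivlMr//; lra.
by rewrite ler_pdivrMr//; have := ler_peMr (ltW X0) k1; lra.
Qed.

Variable T : set (set int).
Hypothesis TP : proper_tubing P T.

Local Notation u J := ((block_bound #|` J|)%:R : R).

(* If J is a tube of T, its own equation determines the gap between its two
   parts.  The bounds on the spread and on the total edge length of the parts,
   whose constants are only tuned to survive the induction, leave this gap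
   larger than n^(2(|J| - 1)), hence larger than the bound of any tube which is
   strictly inside J and crosses the gap. *)
Lemma realize_block J : J != fset0 -> mod_inj n [set` J] ->
  exists x, [/\ forall i, i \in J -> 0 <= x i <= 5 / 4 * u J,
    forall i j, i \in J -> j \in J -> 0 <= edge P x i j,
    cross x J J <= 7 / 20 * n%:R ^+ 2 * u J &
    forall s, proper_tube P s -> s `<=` [set` J] ->
      tube_bound R n s <= alpha_seq P s x /\
      (alpha_seq P s x = tube_bound R n s <-> T s)].
Proof.
have [m] := ubnP #|` J|; elim: m J => // m IH J Jm J0 JI.
have [Jle1|Jgt1] := leqP #|` J| 1.
  have /cardfs1P[z JE] : #|` J| == 1%N by rewrite eqn_leq Jle1 cardfs_gt0.
  have uJ : u J = 0 :> R by rewrite /block_bound ltnNge Jle1.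
  exists 0; rewrite uJ mulr0; split.
  - by move=> i _; rewrite lexx.
  - by move=> i j _ _; rewrite /edge subrr if_same.
  - by rewrite mulr0 JE /cross !big_seq_fset1 edge_xx.
  - move=> s /(card_proper_tube n_gt0)/andP[s2 _] sJ; exfalso.
    have : (#|` fset_set s| <= #|` J|)%N.
      rewrite -(set_fsetK J); apply: fsubset_leq_card; rewrite -fset_set_sub//.
      exact: sub_finite_set sJ _.
    lia.
have [J1 [J2 [[J10 J20 dis JE] low TJ]]] := tubing_split_ex n_gt0 TP Jgt1.
have cardE : #|` J| = (#|` J1| + #|` J2|)%N.
  have /eqP I0 : (J1 `&` J2 == fset0)%fset by rewrite fsetI_eq0.
  by rewrite JE -cardfsUI I0 cardfs0 addn0.
have s1 : (0 < #|` J1|)%N by rewrite cardfs_gt0.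
have s2 : (0 < #|` J2|)%N by rewrite cardfs_gt0.
have J1J i : i \in J1 -> i \in J by move=> iJ1; rewrite JE inE iJ1.
have J2J i : i \in J2 -> i \in J by move=> iJ2; rewrite JE inE iJ2 orbT.
have J2J1 i : i \in J2 -> (i \in J1) = false.
  by move=> iJ2; apply/negbTE/negP => /(fdisjointP dis); rewrite iJ2.
have [||x1 [x1r x1e x1c x1s]] := IH J1 _ J10.
  rewrite -ltnS; apply: leq_trans Jm; rewrite ltnS cardE.
  by rewrite -[X in (X < _)%N]addn0 ltn_add2l.
  by move=> i j /J1J iJ /J1J jJ; exact: JI.
have [||x2 [x2r x2e x2c x2s]] := IH J2 _ J20.
  rewrite -ltnS; apply: leq_trans Jm; rewrite ltnS cardE.
  by rewrite -[X in (X < _)%N]add0n ltn_add2r.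
  by move=> i j /J2J iJ /J2J jJ; exact: JI.
have Jn : (#|` J| <= n)%N by exact: card_mod_inj.
have [] := block_boundD s1 s2; rewrite -cardE// => UM UX.
set u1 := u J1 in x1r x1c; set u2 := u J2 in x2r x2c.
have u10 : 0 <= u1 by rewrite ler0n.
have u20 : 0 <= u2 by rewrite ler0n.
pose nn : R := n%:R ^+ 2; pose M : R := n%:R ^+ (2 * #|` J|.-1).
pose X : R := n%:R ^+ (2 * #|` J|).
have nR : 2 <= n%:R :> R by rewrite (ler_nat R 2) (leq_trans Jgt1).
have M0 : 0 < M by rewrite exprn_gt0//; lra.
have XE : X = nn * M.
  by rewrite /X /nn /M -exprD -mulnS (ltn_predK Jgt1).
have {}UM : u1 + u2 <= M by rewrite /M -natrX -natrD ler_nat.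
have {}UX : 9 * (u1 + u2) <= X by rewrite /X -natrX -natrD -natrM ler_nat.
have uJ : u J = X by rewrite /block_bound Jgt1 natrX.
have nn4 : 4 <= nn by rewrite /nn; nra.
have X0 : 0 < X by rewrite XE mulr_gt0//; lra.
pose d1 := 5 / 4 * u1; pose d2 := 5 / 4 * u2.
pose y : int -> R^o := fun i => if i \in J1 then x1 i else d1 + x2 i.
pose z : int -> R^o := fun i => if i \in J1 then 0 else 1.
have crossJ (w : int -> R^o) :
    cross w J J = cross w J1 J1 + cross w J2 J2 + cross w J1 J2.
  rewrite JE crossUl// !crossUr//.
  by rewrite (@cross_no_cover w J2 J1) ?add0r => [|a b aJ2 bJ1]; [ring|exact: low].
have yJ1 : cross y J1 J1 = cross x1 J1 J1.
  by apply: (@eq_cross x1 y 0) => i iJ1; rewrite /y iJ1 addr0.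
have yJ2 : cross y J2 J2 = cross x2 J2 J2.
  by apply: (@eq_cross x2 y d1) => i iJ2; rewrite /y (J2J1 _ iJ2) addrC.
have zJ1 : cross z J1 J1 = 0.
  rewrite -[RHS](mul0r (cross z J1 J1)) -crossZ; apply: (@eq_cross _ _ 0) => i iJ1;
    by rewrite /z iJ1 addr0 scale0r.
have zJ2 : cross z J2 J2 = 0.
  rewrite -[RHS](mul0r (cross z J2 J2)) -crossZ; apply: (@eq_cross _ _ 1) => i iJ2;
    by rewrite /z (J2J1 _ iJ2) scale0r add0r.
set k := cross z J1 J2.
have k_le : 4 * k <= nn.
  apply: (@le_trans _ _ (4 * (#|` J1| * #|` J2|)%:R)).
    rewrite ler_wpM2l//; apply: cross_le_card => a b aJ1 bJ2.
    by rewrite /edge /z aJ1 (J2J1 _ bJ2); case: ifP; rewrite ?subr0.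
  by rewrite /nn -natrX -natrM ler_nat four_muln_le// -cardE.
have k_ge0 : 0 <= k.
  apply: cross_ge0 => a b aJ1 bJ2; rewrite /edge /z aJ1 (J2J1 _ bJ2).
  by case: ifP; rewrite ?subr0.
set e := cross y J1 J2.
have e_ge0 : 0 <= e.
  apply: cross_ge0 => a b aJ1 bJ2; rewrite /edge /y aJ1 (J2J1 _ bJ2).
  by case: ifP => // _; have := x1r _ aJ1; have := x2r _ bJ2; rewrite /d1; lra.
have e_le : e <= 5 / 4 * (u1 + u2) * k.
  rewrite /k -crossZ; apply: ler_cross => a b aJ1 bJ2.
  rewrite edgeZ /edge /y /z aJ1 (J2J1 _ bJ2).
  by case: ifP => // _; have := x1r _ aJ1; have := x2r _ bJ2; rewrite /d1; lra.
have a1_ge0 : 0 <= cross x1 J1 J1 by exact: cross_ge0.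
have a2_ge0 : 0 <= cross x2 J2 J2 by exact: cross_ge0.
have aU : cross x1 J1 J1 + cross x2 J2 J2 <= 7 / 20 * nn * (u1 + u2).
  by rewrite mulrDr lerD.
set a := cross x1 J1 J1 + cross x2 J2 J2 in aU.
have a_ge0 : 0 <= a by exact: addr_ge0.
have boundX s (m' : nat) : (#|` fset_set s| <= m')%N ->
    tube_bound R n s <= n%:R ^+ (2 * m').
  by move=> sm; rewrite /tube_bound natrX ler_weXn2l ?leq_mul2l//; lra.
have [g [g0 gX gT gs]] : exists g : R, [/\ 0 < g, g <= 17 / 16 * X,
    T [set` J] -> a + e + g * k = X &
    forall s, proper_tube P s -> s `<=` [set` J] -> ~ T s -> tube_bound R n s < g].
  have [TJJ|TJJ] := pselect (T [set` J]); last first.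
    exists (17 / 16 * X); split=> //; first by lra.
    move=> s sP sJ _; apply: (@le_lt_trans _ _ X); last by lra.
    apply: boundX; rewrite -(set_fsetK J); apply: fsubset_leq_card.
    by rewrite -fset_set_sub//; exact: finite_proper_tube sP.
  have k_ge1 : 1 <= k.
    have /fset0Pn[b1 b1J] := J10; have /fset0Pn[b2 b2J] := J20.
    have [[Jc _ _ _] _] := tubing_tube TP TJJ.
    have [||p [q [pJ qJ pJ1 qJ1 pq]]] :=
      @connected_cross n P _ (mem J1) b1 b2 Jc (J1J _ b1J) (J2J _ b2J).
    - by [].
    - by rewrite /= J2J1.
    have qJ2 : q \in J2 by move: qJ; rewrite /= JE inE (negbTE (qJ1 : q \notin J1)).
    have pqc : ap_cover P p q.
      by case/orP: pq => // /ap_cover_lt qp; case: (low _ _ pJ1 qJ2).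
    apply: (@le_trans _ _ (edge P z p q)).
      by rewrite /edge pqc /z (J2J1 _ qJ2) (pJ1 : p \in J1) subr0.
    apply: cross_ge_edge => // a' b' a'J1 b'J2.
    by rewrite /edge /z a'J1 (J2J1 _ b'J2); case: ifP; rewrite ?subr0.
  have [gM gX] := block_bound_facts M0 XE k_ge1 k_le (addr_ge0 u10 u20) UM UX
    a_ge0 aU e_ge0 e_le.
  exists ((X - a - e) / k); split.
  - exact: lt_trans gM.
  - by lra.
  - by move=> _; rewrite divfK ?gt_eqF ?(lt_le_trans ltr01 k_ge1)//; ring.
  - move=> s sP sJ Ts; apply: le_lt_trans gM; apply: boundX.
    have sf := finite_proper_tube n_gt0 sP.
    rewrite -ltnS (ltn_predK Jgt1).
    rewrite -(set_fsetK J); apply: card_fset_set_lt => //.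
    apply: contrapT => H; apply: Ts; suff -> : s = [set` J] by [].
    apply/seteqP; split=> // i iJ; apply: contrapT => si.
    by apply: H; exists i.
pose w : int -> R^o := y + g *: z.
have wJ1 i : i \in J1 -> w i = x1 i + 0.
  by move=> iJ1; rewrite /w !fctE /y /z iJ1 scaler0.
have wJ2 i : i \in J2 -> w i = x2 i + (d1 + g).
  move=> iJ2; rewrite /w !fctE /y /z (J2J1 _ iJ2).
  rewrite -[g *: 1]/(g * 1) mulr1; ring.
have w_edge12 p q : p \in J1 -> q \in J2 -> ap_cover P p q ->
    g <= edge P w p q.
  move=> pJ qJ pq; rewrite /edge pq (wJ1 _ pJ) (wJ2 _ qJ).
  by have := x1r _ pJ; have := x2r _ qJ; rewrite /d1; lra.
have w_edge i j : i \in J -> j \in J -> 0 <= edge P w i j.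
  rewrite JE !inE => /orP[iJ|iJ] /orP[jJ|jJ].
  - by have := x1e _ _ iJ jJ; rewrite /edge (wJ1 _ iJ) (wJ1 _ jJ) !addr0.
  - have := w_edge12 _ _ iJ jJ; rewrite /edge; case: ifP => // _ /(_ isT).
    exact/le_trans/ltW.
  - by rewrite /edge; case: ifP => // /ap_cover_lt /low; case.
  - have := x2e _ _ iJ jJ; rewrite /edge (wJ2 _ iJ) (wJ2 _ jJ).
    by case: ifP => // _; rewrite opprD addrACA subrr addr0.
have wJJ : cross w J J = a + e + g * k.
  by rewrite crossD crossZ !crossJ yJ1 yJ2 zJ1 zJ2 !add0r.
have gk : g * (4 * k) <= 17 / 16 * X * nn by rewrite ler_pM// ?mulr_ge0// ltW.
exists w; rewrite uJ; split.
- move=> i; rewrite JE inE => /orP[iJ|iJ].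
    rewrite (wJ1 _ iJ); have := x1r _ iJ; lra.
  rewrite (wJ2 _ iJ); have := x2r _ iJ; rewrite /d1; lra.
- exact: w_edge.
- rewrite wJJ -/nn.
  have h1 : nn * (9 * (u1 + u2)) <= nn * X by rewrite ler_wpM2l//; lra.
  have h2 : (u1 + u2) * (4 * k) <= (u1 + u2) * nn by rewrite ler_wpM2l//; lra.
  lra.
- move=> s sP sJ; have sf := finite_proper_tube n_gt0 sP.
  have [sJ1|sJ1] := pselect (s `<=` [set` J1]).
    rewrite (@eq_alpha_seq _ _ P s x1 w 0)//; first exact: x1s.
    by move=> i /sJ1; exact: wJ1.
  have [sJ2|sJ2] := pselect (s `<=` [set` J2]).
    rewrite (@eq_alpha_seq _ _ P s x2 w (d1 + g))//; first exact: x2s.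
    by move=> i /sJ2; exact: wJ2.
  have [p [q [sp sq pJ1 qJ2 pq]]] : exists p q,
      [/\ s p, s q, p \in J1, q \in J2 & ap_cover P p q].
    have [b1 [sb1 b1J]] : exists b, s b /\ b \in J1.
      apply: contrapT => H; apply: sJ2 => i si; have := sJ _ si.
      rewrite /= JE inE => /orP[iJ1|//]; by case: H; exists i.
    have [b2 [sb2 b2J]] : exists b, s b /\ b \in J2.
      apply: contrapT => H; apply: sJ1 => i si; have := sJ _ si.
      rewrite /= JE inE => /orP[//|iJ2]; by case: H; exists i.
    have [[sc _ _ _] _] := sP.
    have [||p [q [sp sq pJ1 qJ1 pq]]] :=
      @connected_cross n P _ (mem J1) b1 b2 sc sb1 sb2.
    - by [].
    - by rewrite /= J2J1.
    have qJ2 : q \in J2.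
      by have := sJ _ sq; rewrite /= JE inE (negbTE (qJ1 : q \notin J1)).
    exists p, q; split=> //; case/orP: pq => // /ap_cover_lt qp.
    by case: (low _ _ pJ1 qJ2).
  have [Ts|Ts] := pselect (T s).
    have sE : s = [set` J] by case: (TJ _ Ts sJ).
    have -> : alpha_seq P s w = tube_bound R n s.
      rewrite alpha_seq_cross// sE set_fsetK wJJ /tube_bound set_fsetK natrX.
      by apply: gT; rewrite -sE.
    by split.
  have lt : tube_bound R n s < alpha_seq P s w.
    apply: lt_le_trans (gs _ sP sJ Ts) _.
    apply: le_trans (w_edge12 _ _ pJ1 qJ2 pq) _.
    rewrite alpha_seq_cross//; apply: cross_ge_edge.
    - move=> i j; rewrite !in_fset_set// !inE => /sJ iJ /sJ jJ.
      exact: w_edge.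
    - by rewrite in_fset_set// inE.
    - by rewrite in_fset_set// inE.
  split; first exact: ltW.
  by split=> [E|//]; move: lt; rewrite E ltxx.
Qed.

End Realize.

Section FundamentalDomain.
Variables (n : nat) (P : affine_poset n).
Hypothesis n_gt0 : (0 < n)%N.
Implicit Types (i j k : int) (s t : set int).
Variable T : set (set int).
Hypothesis TP : proper_tubing P T.

Let maxT t := T t /\ forall r, T r -> t `<=` r -> r = t.

Let maxT_above t : T t -> exists2 s, maxT s & t `<=` s.
Proof.
move=> Tt; have [|s [Ts ts smax]] := @maximal_set_above T n t _ Tt.
  by move=> s /(tubing_bounded n_gt0 TP).
by exists s.
Qed.

Let maxT_dis s t : maxT s -> maxT t -> s = t \/ disjoint_tubes s t.
Proof.
move=> [Ts smax] [Tt tmax].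
have [[st|ts]|] := tubing_nested TP Ts Tt; last by right.
  by left; apply/esym/smax.
by left; exact: tmax.
Qed.

(* The smallest lower set containing 0 which is a union of tubes of T and of
   singletons; acyclicity of T is what keeps n outside of it. *)
Definition cut_below j := P j 0 \/ exists (m : nat) (t : nat -> set int),
  [/\ forall l, (l <= m)%N -> maxT (t l),
      forall l, (l < m)%N -> tube_prec P (t l) (t l.+1),
      exists2 a, t 0%N a & P j a &
      exists2 b, t m b & P b 0].

Let cut_below_le i j : P i j -> cut_below j -> cut_below i.
Proof.
move=> ij [j0|[m [t [tT tt [a ta ja] b0]]]]; first by left; exact: ap_trans ij j0.
by right; exists m, t; split=> //; exists a => //; exact: ap_trans ij ja.
Qed.

Let cut_below_tube t i j : T t -> t i -> t j -> cut_below i -> cut_below j.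
Proof.
move=> /maxT_above[s sT ts] /ts si /ts sj [i0|[m [r [rT rr [a ra ia] b0]]]].
  by right; exists 0%N, (fun=> s); split=> //; [exists j; rewrite ?ap_refl|exists i].
have [sr|sr] := maxT_dis sT (rT _ (leq0n m)).
  by right; exists m, r; split=> //; exists j; rewrite -?sr ?ap_refl.
right; exists m.+1, (fun l => if l is l'.+1 then r l' else s); split=> //.
- by case=> // l; exact: rT.
- case=> [_|l]; last exact: rr.
  split=> //; exists i, a; split=> //.
  have [ia_eq|//] := ap_le_eqVlt ia.
  have : (s `&` r 0%N) i by split=> //; rewrite ia_eq.
  by rewrite sr.
- by exists j; rewrite ?ap_refl.
Qed.

Let cut_below0 : cut_below 0. Proof. by left; exact: ap_refl. Qed.

Let cut_belown : ~ cut_below n%:Z.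
Proof.
have lt0n : ap_lt P 0 n%:Z.
  by rewrite -[X in ap_lt P 0 X]add0r -[n%:Z in X in ap_lt P 0 X]mul1r ap_lt_period.
move=> [n0|[m [t [tT tt [a ta na] [b tb b0]]]]].
  by have := ap_lt_le_trans lt0n n0; rewrite ap_ltxx.
have ba : ap_lt P b a by apply: ap_le_lt_trans b0 (ap_lt_le_trans lt0n na).
have [Tt _] := tT _ (leq0n m); have tP := tubing_tube TP Tt.
have [tE|tE] := maxT_dis (tT _ (leqnn m)) (tT _ (leq0n m)).
  have tV : ap_convex P (t 0%N) by case: tP => -[].
  rewrite tE in tb.
  have t0 : t 0%N 0 by apply: tV tb ta b0 _; exact: ap_trans (ap_lt_le lt0n) na.
  have tn : t 0%N (0 + 1 * n%:Z).
    by rewrite add0r mul1r; apply: tV tb ta _ na; exact: ap_trans b0 (ap_lt_le lt0n).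
  by have := mod_inj_period n_gt0 (proper_tube_mod_inj tP) t0 tn.
case: TP => _ _ _ /(_ m t); apply.
- by move=> l lm; have [] := tT _ lm.
- exact: tt.
- by split=> //; exists b, a.
Qed.

Lemma exists_level : exists lev : int -> int,
  [/\ forall i k, lev (i + k * n%:Z) = lev i + k,
      forall i j, P i j -> lev i <= lev j &
      forall t i j, T t -> t i -> t j -> lev i = lev j].
Proof.
pose D j := cut_below (j - n%:Z) /\ ~ cut_below j.
have shiftE i k l : l <= k -> P (i + l * n%:Z) (i + k * n%:Z).
  move=> lk; have -> : i + k * n%:Z = i + l * n%:Z + (absz (k - l)%R)%:Z * n%:Z.
    by rewrite gez0_abs ?subr_ge0//; ring.
  exact: ap_le_period.
have D_uniq i k l : D (i + k * n%:Z) -> D (i + l * n%:Z) -> k = l.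
  have lt a b : a < b -> D (i + a * n%:Z) -> D (i + b * n%:Z) -> False.
    move=> ab [_ H] [+ _]; apply: contra_not H; apply: cut_below_le.
    have -> : i + b * n%:Z - n%:Z = i + (b - 1) * n%:Z by ring.
    by apply: shiftE; lia.
  by move=> Dk Dl; have [kl|kl|//] := ltgtP k l; [case: (lt _ _ kl)|case: (lt _ _ kl)].
have D_ex i : exists k, D (i - k * n%:Z).
  have [k0 Pk0] := ap_cofinal P i 0; have [k1 Pk1] := ap_cofinal P n%:Z i.
  have low k : k <= - k0 -> cut_below (i + k * n%:Z).
    move=> kk; apply: cut_below_le cut_below0.
    apply: ap_trans (shiftE i _ _ kk) _.
    by rewrite -(ap_shift _ _ _ k0) mulNr subrK.
  have high k : k1 <= k -> ~ cut_below (i + k * n%:Z).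
    move=> kk; apply: contra_not cut_belown; apply: cut_below_le.
    exact: ap_trans Pk1 (shiftE i _ _ kk).
  have ex : exists m : nat, `[< ~ cut_below (i + (m%:Z - k0) * n%:Z) >].
    by exists (absz (k1 + k0)%R); apply/asboolP/high; lia.
  case: (ex_minnP ex) => -[|m] /asboolP Um mmin.
    by case: Um; apply: low; lia.
  exists (k0 - m.+1%:Z); split.
    have -> : i - (k0 - m.+1%:Z) * n%:Z - n%:Z = i + (m%:Z - k0) * n%:Z.
      by rewrite intS; ring.
    apply: contrapT => H; suff : (m.+1 <= m)%N by rewrite ltnn.
    by apply: mmin; apply/asboolP.
  by have -> : i - (k0 - m.+1%:Z) * n%:Z = i + (m.+1%:Z - k0) * n%:Z by ring.
have /choice[lev levP] := D_ex; exists lev.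
have levE i k : D (i - k * n%:Z) -> lev i = k.
  move=> Dk; apply: oppr_inj; apply: (D_uniq i); first by rewrite mulNr.
  by rewrite mulNr.
split.
- move=> i k; apply: levE; have := levP i; congr D; ring.
- move=> i j ij; rewrite leNgt; apply/negP => ji.
  have [_ H] := levP i; have [H' _] := levP j; apply: H.
  apply: cut_below_le H'.
  have -> : j - lev j * n%:Z - n%:Z = j + (- lev j - 1) * n%:Z by ring.
  rewrite -mulNr; apply: ap_trans (shiftE i (- lev j - 1) _ _) _; first by lia.
  by rewrite ap_shift.
- move=> t i j Tt ti tj; apply/esym/levE; have [H H'] := levP i.
  split.
    have -> : j - lev i * n%:Z - n%:Z = j + (- lev i - 1) * n%:Z by ring.
    apply: (@cut_below_tube (shift_set n t (- lev i - 1))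
      (i - lev i * n%:Z - n%:Z)) => //.
    + exact: (tubing_shift TP).
    + by rewrite shift_setE (_ : _ - _ = i)//; ring.
    + by rewrite shift_setE addrK.
  apply: contra_not H'.
  apply: (@cut_below_tube (shift_set n t (- lev i))).
  + exact: (tubing_shift TP).
  + by rewrite -mulNr shift_setE addrK.
  + by rewrite -mulNr shift_setE addrK.
Qed.

End FundamentalDomain.

Section RealizeTubing.
Variables (R : realType) (n : nat) (P : affine_poset n).
Hypothesis n_gt0 : (0 < n)%N.
Implicit Types (i j k : int) (s t : set int) (x : int -> R^o).

Lemma realize_tubing (T : set (set int)) : proper_tubing P T ->
  exists x : int -> R^o, [/\ quasi_periodic n x,
    forall s, proper_tube P s -> tube_bound R n s <= alpha_seq P s x &
    tight_tubes P x = T].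
Proof.
move=> TP; have [lev [lev_shift lev_le lev_tube]] := exists_level n_gt0 TP.
pose J0 := [set i | lev i = 0].
have base0 i : J0 (i - lev i * n%:Z).
  by rewrite /J0 /= -mulNr lev_shift subrr.
have J0f : finite_set J0.
  apply: sub_finite_set (finite_image (fun i => i - lev i * n%:Z)
    (finite_int_range 0 n%:Z)) => i /= i0; exists (i %% n%:Z)%Z.
    by rewrite modz_ge0 ?ltW ?ltz_pmod//=; lia.
  have iE := divz_eq i n%:Z; set q := (i %/ n%:Z)%Z in iE.
  have : lev i = lev (i %% n%:Z)%Z + q by rewrite -lev_shift addrC -iE.
  rewrite i0 => /eqP; rewrite eq_sym addr_eq0 => /eqP->.
  by rewrite mulNr opprK addrC -iE.
pose J := fset_set J0.
have inJ i : (i \in J) = (lev i == 0).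
  by rewrite in_fset_set//; apply/idP/idP; rewrite inE => /eqP.
have JI : mod_inj n [set` J].
  move=> i j /=; rewrite !inJ => /eqP i0 /eqP j0 /mod_eq_shift[k jE].
  by move: j0; rewrite jE lev_shift i0 add0r => ->; rewrite mul0r addr0.
have Jn0 : J != fset0.
  by apply/fset0Pn; exists (0 - lev 0 * n%:Z); rewrite inJ; apply/eqP/base0.
have [x0 [x0r x0e _ x0s]] := realize_block R n_gt0 TP Jn0 JI.
pose x : int -> R^o := fun i => x0 (i - lev i * n%:Z) + (lev i)%:~R * period_shift R n.
have xq : quasi_periodic n x.
  move=> i; have L : lev (i + n%:Z) = lev i + 1 by rewrite -[n%:Z]mul1r lev_shift.
  have E : i + n%:Z - (lev i + 1) * n%:Z = i - lev i * n%:Z by ring.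
  by rewrite /x L E intrD; ring.
have xJ i k : J0 i -> x (i + k * n%:Z) = x0 i + k%:~R * period_shift R n.
  by move=> i0; rewrite /x lev_shift i0 add0r addrK.
have Jn : (#|` J| <= n)%N by exact: card_mod_inj.
set u : R := 5 / 4 * (block_bound n #|` J|)%:R in x0r.
have jump i j : (1 < n)%N -> lev i < lev j -> n%:R ^+ (2 * n) < x j - x i.
  move=> n2 ij; rewrite /x.
  have jJ : j - lev j * n%:Z \in J by rewrite inJ; apply/eqP/base0.
  have iJ : i - lev i * n%:Z \in J by rewrite inJ; apply/eqP/base0.
  have /andP[j0 ju] := x0r _ jJ; have /andP[i0 iu] := x0r _ iJ.
  have uN : u <= 5 / 4 * n%:R ^+ (2 * n).
    rewrite /u ler_pM2l ?divr_gt0// -natrX ler_nat /block_bound; case: ifP => // _.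
    by rewrite leq_pexp2l// leq_mul2l.
  have c0 := period_shift_gt0 R n_gt0.
  have cE : 4 * n%:R ^+ (2 * n) <= period_shift R n.
    rewrite /period_shift natrX mulnS exprD ler_pM2r ?exprn_gt0 ?ltr0n//.
    by rewrite -natrX ler_nat (leq_exp2r 2 n (e := 2)).
  have N0 : 0 < n%:R ^+ (2 * n) :> R by rewrite exprn_gt0// ltr0n.
  have : 1 <= (lev j)%:~R - (lev i)%:~R :> R.
    by rewrite -intrB ler1z -gtz0_ge1 subr_gt0.
  move=> /(ler_wpM2r (ltW c0)); rewrite mul1r mulrBl; lra.
have x_edge i j : (1 < n)%N -> 0 <= edge P x i j.
  move=> n2; rewrite /edge; case: ifP => // ij.
  have := lev_le _ _ (ap_lt_le (ap_cover_lt ij)).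
  rewrite le_eqVlt => /orP[/eqP lE|]; last first.
    by move=> /(jump _ _ n2)/ltW; apply: le_trans; rewrite exprn_ge0.
  rewrite /x lE opprD addrACA subrr addr0.
  have := x0e (i - lev i * n%:Z) (j - lev i * n%:Z); rewrite !inJ -!mulNr !lev_shift lE.
  by rewrite subrr eqxx => /(_ isT isT); rewrite /edge ap_cover_shift ij !mulNr.
have xs s : proper_tube P s -> tube_bound R n s <= alpha_seq P s x /\
    (alpha_seq P s x = tube_bound R n s <-> T s).
  move=> sP; have sf := finite_proper_tube n_gt0 sP.
  have /andP[s2 sn] := card_proper_tube n_gt0 sP.
  have n2 : (1 < n)%N by exact: leq_trans sn.
  have [p sp] := proper_tube_neq0 sP.
  have [allp|] := pselect (forall q, s q -> lev q = lev p).
    pose s' := shift_set n s (- lev p).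
    have s'P : proper_tube P s' by exact: proper_tube_shift.
    have s'f := finite_proper_tube n_gt0 s'P.
    have sE : s = shift_set n s' (lev p) by rewrite shift_setNK.
    have s'J i : s' i -> J0 i.
      move=> /shift_setP/allp; rewrite -mulNr opprK lev_shift.
      by rewrite -[RHS]add0r => /addIr.
    have aE : alpha_seq P s x = alpha_seq P s' x0.
      rewrite {1}sE; apply: (alpha_seq_shift _ s'f) => i /s'J; exact: xJ.
    have bE : tube_bound R n s = tube_bound R n s'.
      by rewrite /tube_bound (card_shift_set n_gt0 _ sP).
    have [|b1 b2] := x0s _ s'P; first by move=> i /s'J /eqP; rewrite /= inJ.
    rewrite aE bE; split=> //; split=> [/b2|Ts]; last first.
      by apply/b2; exact: (tubing_shift TP).
    by rewrite sE; exact: (tubing_shift TP).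
  move=> /existsNP[q /not_implyP[sq /eqP qp]].
  have [[sc _ _ _] _] := sP.
  have [||a [b [sa sb ap bp ab]]] :=
    @connected_cross n P _ (fun i => lev i == lev p) p q sc sp sq.
  - exact: eqxx.
  - exact: qp.
  have {ap bp} lab : lev a != lev b by apply: contraNneq bp => <-.
  have {a b sa sb ab lab} [a [b [sa sb ab lab]]] :
      exists a b, [/\ s a, s b, ap_cover P a b & lev a < lev b].
    case/orP: ab => ab; [exists a, b|exists b, a]; split=> //.
      by rewrite lt_neqAle lab lev_le//; exact: ap_lt_le (ap_cover_lt ab).
    by rewrite lt_neqAle eq_sym lab lev_le//; exact: ap_lt_le (ap_cover_lt ab).
  have lt : tube_bound R n s < alpha_seq P s x.
    apply: (@le_lt_trans _ _ (n%:R ^+ (2 * n))).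
      by rewrite /tube_bound natrX ler_weXn2l ?leq_mul2l// ler1n.
    apply: lt_le_trans (jump _ _ n2 lab) _.
    have -> : x b - x a = edge P x a b by rewrite /edge ab.
    rewrite alpha_seq_cross//; apply: cross_ge_edge.
    - by move=> i j _ _; exact: x_edge.
    - by rewrite in_fset_set// inE.
    - by rewrite in_fset_set// inE.
  split; first exact: ltW.
  split=> [E|Ts]; first by move: lt; rewrite E ltxx.
  by move: lab; rewrite (lev_tube _ _ _ Ts sa sb) ltxx.
exists x; split=> //; first by move=> s /xs[].
apply/seteqP; split=> [s [sP /(xs s sP).2//]|s Ts].
have sP := tubing_tube TP Ts; split=> //.
by apply/(xs s sP).2.
Qed.

End RealizeTubing.

(** * Simple polyhedra *)

Section Dimension.
Variables (R : realType) (V : lmodType R).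
Implicit Types (F : set V).

Lemma has_dim_base F m (q : V) (f : 'I_m -> V) :
  F q -> (forall k, F (q + f k)) ->
  (forall a : 'I_m -> R, \sum_k a k *: f k = 0 -> forall k, a k = 0) ->
  (forall x, F x -> exists a : 'I_m -> R, x = q + \sum_k a k *: f k) ->
  has_dim F m.
Proof.
move=> Fq Ff f_indep f_span.
pose p (j : 'I_m.+1) := if unlift ord0 j is Some k then q + f k else q.
have p0 : p ord0 = q by rewrite /p unlift_none.
have pS k : p (lift ord0 k) = q + f k by rewrite /p liftK.
have sumE (a : 'I_m.+1 -> R) : \sum_j a j *: p j =
    (\sum_j a j) *: q + \sum_k a (lift ord0 k) *: f k.
  rewrite !big_ord_recl /= p0 scalerDl -addrA; congr (_ + _).
  rewrite scaler_suml -big_split; apply: eq_bigr => k _ /=.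
  by rewrite pS scalerDr.
exists p; split.
- by move=> j; rewrite /p; case: unlift.
- move=> a a0; rewrite sumE a0 scale0r add0r => /f_indep ak j.
  case: (unliftP ord0 j) => [k ->|->]; first exact: ak.
  by move: a0; rewrite big_ord_recl big1 ?addr0.
- move=> x /f_span[c ->].
  pose b (j : 'I_m.+1) := if unlift ord0 j is Some k then c k else 1 - \sum_k c k.
  have bS k : b (lift ord0 k) = c k by rewrite /b liftK.
  have b1 : \sum_j b j = 1.
    rewrite big_ord_recl (eq_bigr (fun k => c k)) => [|k _]; last exact: bS.
    by rewrite /b unlift_none subrK.
  exists b; split=> //; rewrite sumE b1 scale1r; congr (_ + _).
  by apply: eq_bigr => k _; rewrite bS.
Qed.

Lemma aff_indep_le m k (p : 'I_m -> V) (q : 'I_k -> V) :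
  aff_indep p -> (forall i, aff_hull q (p i)) -> (m <= k)%N.
Proof.
move=> p_indep /choice[M pM]; rewrite leqNgt; apply/negP => km.
pose A := \matrix_(i < m, j < k) M i j.
have : kermx A != 0.
  rewrite -mxrank_eq0 mxrank_ker -lt0n subn_gt0.
  exact: leq_ltn_trans (rank_leq_col A) km.
rewrite -nz_row_eq0; set v := nz_row _ => v0.
have vA : v *m A = 0 by apply/eqP; rewrite -sub_kermx; exact: nz_row_sub.
have vM j : \sum_i v 0 i * M i j = 0.
  have /(congr1 (fun B : 'M_(1, k) => B 0 j)) 
  := vA; rewrite !mxE => E; rewrite -[RHS]E.
  by apply: eq_bigr => i _; rewrite mxE.
suff v_eq0 : v = 0 by rewrite v_eq0 eqxx in v0.
apply/rowP => i; rewrite mxE; apply: (p_indep (v 0)).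
  transitivity (\sum_i \sum_j v 0 i * M i j).
    by apply: eq_bigr => l _; rewrite -mulr_sumr (proj1 (pM l)) mulr1.
  by rewrite exchange_big big1.
transitivity (\sum_i \sum_j (v 0 i * M i j) *: q j).
  apply: eq_bigr => l _; rewrite [p l](proj2 (pM l)) scaler_sumr.
  by apply: eq_bigr => j _; rewrite scalerA.
by rewrite exchange_big big1// => j _; rewrite -scaler_suml vM scale0r.
Qed.

Lemma has_dim_uniq F d1 d2 : has_dim F d1 -> has_dim F d2 -> d1 = d2.
Proof.
move=> [p [Fp p_indep pF]] [q [Fq q_indep qF]].
have := aff_indep_le p_indep (fun i => qF _ (Fp i)).
have := aff_indep_le q_indep (fun i => pF _ (Fq i)).
by move=> le1 le2; apply/eqP; rewrite eqn_leq -ltnS le2 -ltnS le1.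
Qed.

Lemma conv_hull_point m (p : 'I_m -> V) i : conv_hull p (p i).
Proof.
exists (fun j => (j == i)%:R); split.
- by move=> j; rewrite ler0n.
- by rewrite (bigD1 i)//= eqxx big1 ?addr0// => j /negbTE->.
- rewrite (bigD1 i)//= eqxx scale1r big1 ?addr0// => j /negbTE->.
  by rewrite scale0r.
Qed.

Lemma conv_hull_convex m (p : 'I_m -> V) x y (t : R) : 0 <= t <= 1 ->
  conv_hull p x -> conv_hull p y -> conv_hull p (t *: x + (1 - t) *: y).
Proof.
move=> /andP[t0 t1] [a [a0 a1 ->]] [b [b0 b1 ->]].
exists (fun i => t * a i + (1 - t) * b i); split.
- by move=> i; rewrite addr_ge0// mulr_ge0// subr_ge0.
- by rewrite big_split /= -!mulr_sumr a1 b1 !mulr1 subrKC.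
- rewrite !scaler_sumr -big_split; apply: eq_bigr => i _ /=.
  by rewrite [RHS]scalerDl !scalerA.
Qed.

End Dimension.

Lemma small_scale (R : realFieldType) (I : finType) (a b : I -> R) :
  (forall i, 0 < a i) -> exists2 s : R, 0 < s & forall i, s * b i <= a i.
Proof.
move=> a0; pose B := 1 + \sum_i `|b i| / a i.
have c0 i : 0 <= `|b i| / a i by rewrite divr_ge0// ltW.
have B0 : 0 < B by rewrite ltr_wpDr// sumr_ge0.
exists B^-1; first by rewrite invr_gt0.
move=> i; rewrite mulrC ler_pdivrMr//; apply: le_trans (ler_norm _) _.
rewrite -ler_pdivrMl// mulrC /B (bigD1 i)//= addrCA lerDl.
by rewrite addr_ge0// sumr_ge0.
Qed.

Section Polyhedron.
Variables (R : realType) (V : lmodType R) (I : finType) (D : set V) (o : V).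
Variables (al : I -> V -> R) (N : I -> R).
Hypothesis D0 : D 0.
Hypothesis DP : forall (a : R) u v, D u -> D v -> D (a *: u + v).
Hypothesis al_linear : forall i (a : R) u v, al i (a *: u + v) = a * al i u + al i v.

Definition polyhedron : set V := [set p | D (p - o) /\ forall i, N i <= al i p].
Local Notation A := polyhedron.

Definition tight p : {set I} := [set i | al i p == N i].

Definition realized S := exists2 p, A p & tight p = S.

Definition max_realized S :=
  realized S /\ forall S' : {set I}, realized S' -> S \subset S' -> S' = S.

Definition tight_face (S : {set I}) : set V :=
  A `&` [set p | forall i, i \in S -> al i p = N i].

Hypothesis bounded : forall w, D w -> (forall i, 0 <= al i w) -> w = 0.
Hypothesis realized_sub : forall S S' : {set I},
  realized S -> S' \subset S -> realized S'.

Let al0 i : al i 0 = 0.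
Proof.
have := al_linear i 0 0 0; rewrite scaler0 addr0 mul0r add0r => e.
by have := al_linear i (-1) 0 0; rewrite scaler0 addr0 mulN1r addNr.
Qed.

Let alD i u v : al i (u + v) = al i u + al i v.
Proof. by have := al_linear i 1 u v; rewrite scale1r mul1r. Qed.

Let alZ i (a : R) u : al i (a *: u) = a * al i u.
Proof. by have := al_linear i a u 0; rewrite !addr0 al0 addr0. Qed.

Let alB i u v : al i (u - v) = al i u - al i v.
Proof. by rewrite -scaleN1r alD alZ mulN1r. Qed.

Let al_sum i (J : Type) (r : seq J) (F : J -> V) :
  al i (\sum_(j <- r) F j) = \sum_(j <- r) al i (F j).
Proof. exact: (big_morph _ (alD i) (al0 i)). Qed.

Let DD u v : D u -> D v -> D (u + v).
Proof. by move=> Du Dv; rewrite -[u]scale1r; exact: DP. Qed.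

Let DZ (a : R) u : D u -> D (a *: u).
Proof. by move=> Du; rewrite -[_ *: _]addr0; exact: DP. Qed.

Let DB u v : D u -> D v -> D (u - v).
Proof. by move=> Du Dv; rewrite -scaleN1r addrC; exact: DP. Qed.

Let Dsum (J : Type) (r : seq J) (F : J -> V) :
  (forall j, D (F j)) -> D (\sum_(j <- r) F j).
Proof.
by move=> DF; elim/big_ind: _ => //; exact: DD.
Qed.

Let DBo p q : A p -> A q -> D (p - q).
Proof. by move=> [Dp _] [Dq _]; have := DB Dp Dq; rewrite opprB subrKA. Qed.

Lemma tightP p i : i \in tight p -> al i p = N i.
Proof. by rewrite inE => /eqP. Qed.

Lemma face_escape p w : A p -> D w -> w <> 0 ->
  (forall i, i \in tight p -> al i w = 0) ->
  exists2 s : R, 0 < s & A (p + s *: w) /\ tight p \proper tight (p + s *: w).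
Proof.
move=> [Dp Ap] Dw w0 tw.
have [i0 i0w] : exists i, al i w < 0.
  apply: contrapT => H; apply: w0; apply: bounded => // i.
  by rewrite leNgt; apply/negP => wi; apply: H; exists i.
pose r i := (al i p - N i) / - al i w.
case: (arg_minP r (P := fun i => al i w < 0) i0w) => j jw jmin.
have jt : j \notin tight p.
  by apply: contraL jw => /tw ->; rewrite ltxx.
have s0 : 0 < r j.
  rewrite divr_gt0 ?oppr_gt0// subr_gt0 lt_neqAle Ap andbT eq_sym.
  by move: jt; rewrite inE.
have alE i : al i (p + r j *: w) = al i p + r j * al i w by rewrite alD alZ.
exists (r j) => //; split; first split.
- by rewrite addrAC; apply: DD => //; exact: DZ.
- move=> i; rewrite alE; have [iw|iw] := leP 0 (al i w).
    by apply: le_trans (Ap i) _; rewrite lerDl mulr_ge0// ltW.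
  have := jmin _ iw; rewrite {2}/r ler_pdivlMr ?oppr_gt0// mulrN => H.
  by move: H; set z := r j * _; lra.
- apply/properP; split.
    by apply/fintype.subsetP => i it; rewrite inE alE tw// mulr0 addr0 tightP.
  exists j => //; rewrite inE alE; apply/eqP.
  have jw0 : al j w != 0 by rewrite lt_eqF.
  by rewrite /r; field.
Qed.

Lemma max_realized_dir p w : A p -> max_realized (tight p) -> D w ->
  (forall i, i \in tight p -> al i w = 0) -> w = 0.
Proof.
move=> Ap [_ tmax] Dw tw; apply: contrapT => w0.
have [s _ [As /properP[st [i is_ ip]]]] := face_escape Ap Dw w0 tw.
have E := tmax _ (ex_intro2 _ _ _ As erefl) st.
by move: ip; rewrite -E is_.
Qed.

Lemma max_realized_uniq p q : A p -> A q -> max_realized (tight p) ->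
  (forall i, i \in tight p -> al i q = N i) -> q = p.
Proof.
move=> Ap Aq pmax tq; apply/eqP; rewrite -subr_eq0; apply/eqP.
apply: (max_realized_dir Ap pmax); first exact: DBo.
by move=> i it; rewrite alB tq// tightP// subrr.
Qed.

Lemma max_realized_ex S : realized S -> exists2 M, max_realized M & S \subset M.
Proof.
move=> rS.
have [M Mmax SM] := maxset_exists (P := fun S => `[< realized S >]) (asboolT rS).
exists M => //; have /maxsetP[/asboolP rM Mm] := Mmax; split=> // S' rS' MS'.
by apply: Mm => //; exact/asboolP.
Qed.

Lemma small_step p w : A p -> D w -> (forall i, i \in tight p -> 0 <= al i w) ->
  exists2 s : R, 0 < s & A (p + s *: w).
Proof.
move=> [Dp Ap] Dw tw.
have [|s s0 sP] := @small_scale R I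
  (fun i => if i \in tight p then 1 else al i p - N i)
  (fun i => if i \in tight p then 0 else - al i w).
  move=> i; case: ifPn => // it; rewrite subr_gt0 lt_neqAle Ap andbT eq_sym.
  by move: it; rewrite inE.
exists s => //; split; first by rewrite addrAC; apply: DD => //; exact: DZ.
move=> i; rewrite alD alZ; have := sP i; case: ifPn => [it _|it].
  by apply: le_trans (Ap i) _; rewrite lerDl mulr_ge0 ?tw// ltW.
lra.
Qed.

Lemma polyhedron_convex m (p : 'I_m -> V) : (forall i, A (p i)) -> conv_hull p `<=` A.
Proof.
move=> Ap _ [a [a0 a1 ->]]; split.
  rewrite -[o]scale1r -a1 scaler_suml -sumrB; apply: Dsum => i.
  by rewrite -scalerBr; apply: DZ; case: (Ap i).
move=> i; rewrite al_sum -[leLHS]mul1r -a1 mulr_suml; apply: ler_sum => j _.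
by rewrite alZ ler_wpM2l//; case: (Ap j).
Qed.

Lemma polyhedron_polytope : polytope A.
Proof.
have [[q Aq]|A0] := pselect (exists q, A q); last first.
  exists 0%N, (fun _ => 0); apply/seteqP; split=> x.
    by move=> Ax; case: A0; exists x.
  by move=> [a [_]]; rewrite big_ord0 => /esym/eqP; rewrite oner_eq0.
have /choice[v vP] : forall S, exists p, A p /\ (realized S -> tight p = S).
  move=> S; have [[p Ap tp]|] := pselect (realized S); first by exists p.
  by exists q.
pose p (j : 'I_#|{set I}|) := v (enum_val j).
have Av S : A (v S) by case: (vP S).
have pv S : p (enum_rank S) = v S by rewrite /p enum_rankK.
exists _, p; apply/seteqP; split; last by apply: polyhedron_convex => j; exact: Av.
move=> x; have [m] := ubnP (#|I| - #|tight x|); elim: m x => // m IH x xm Ax.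
have [xmax|xmax] := pselect (max_realized (tight x)).
  suff <- : v (tight x) = x by rewrite -pv; exact: conv_hull_point.
  apply: max_realized_uniq => // i it; apply: tightP.
  by rewrite (proj2 (vP (tight x)))//; case: xmax.
have [S' [y Ay yS'] xS'] : exists2 S', realized S' & tight x \proper S'.
  have [|M [rM Mmax] xM] := @max_realized_ex (tight x); first by exists x.
  exists M => //; rewrite finset.properEneq xM andbT; apply/eqP => xE.
  by apply: xmax; rewrite xE; split.
rewrite -{S'}yS' in xS'.
have [s s0 [Az xz]] : exists2 s : R, 0 < s &
    A (x + s *: (x - y)) /\ tight x \proper tight (x + s *: (x - y)).
  apply: face_escape => //; first exact: DBo.
    by move/eqP; rewrite subr_eq0 => /eqP xy; move: xS'; rewrite xy fintype.properxx.
  move=> i it; rewrite alB (tightP it) tightP ?subrr//.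
  by move/properP: xS' => [/fintype.subsetP + _]; exact.
have lt_card z : tight x \proper tight z -> (#|I| - #|tight z| < m)%N.
  move=> /proper_card xz'; rewrite -ltnS; apply: leq_trans xm; rewrite ltnS.
  by apply: ltn_sub2l => //; apply: leq_trans xz' (max_card _).
have s1 : 1 + s != 0 by rewrite gt_eqF// addr_gt0.
have -> : x = (1 + s)^-1 *: (x + s *: (x - y)) + (1 - (1 + s)^-1) *: y.
  apply: (scalerI s1); rewrite scalerDr !scalerA mulfV// scale1r mulrBr mulfV//.
  by rewrite mulr1 (addrC 1) addrK scalerBr scalerDl scale1r addrA subrK addrC.
apply: conv_hull_convex.
- rewrite invr_ge0 invf_le1; last by rewrite addr_gt0.
  by rewrite lerDl (ltW s0) addr_ge0// ltW.
- exact: IH (lt_card _ xz) Az.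
- exact: IH (lt_card _ xS') Ay.
Qed.

Lemma tight_face_tight p : A p -> tight_face (tight p) p.
Proof. by move=> Ap; split=> // i; exact: tightP. Qed.

Lemma tight_face_sub (S1 S2 : {set I}) : realized S1 ->
  (tight_face S1 `<=` tight_face S2 <-> S2 \subset S1).
Proof.
move=> [p Ap <-]; split=> [/(_ _ (tight_face_tight Ap))[_ pS2]|S21].
  by apply/fintype.subsetP => i /pS2 e; rewrite inE; apply/eqP.
by move=> x [Ax xS]; split=> // i /(fintype.subsetP S21); exact: xS.
Qed.

Lemma linear_of (f : V -> R) : (forall (a : R) u v, f (a *: u + v) = a * f u + f v) ->
  exists phi : {linear V -> R^o}, forall x, phi x = f x.
Proof.
move=> f_lin.
pose m := GRing.isLinear.Build R V R^o *:%R (f : V -> R^o) f_lin.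
pose phi : {linear V -> R^o} := HB.pack (f : V -> R^o) m.
by exists phi.
Qed.

Lemma tight_face_face S : face A (tight_face S).
Proof.
have [|phi phiE] := @linear_of (fun x => - \sum_(i in S) al i x).
  move=> a u v; rewrite mulrN -opprD mulr_sumr -big_split; congr (- _).
  by apply: eq_bigr => i _; rewrite al_linear.
exists phi, (- \sum_(i in S) N i); split.
  by move=> x [_ Ax]; rewrite phiE lerN2; exact: ler_sum.
apply/seteqP; split=> x [Ax xS]; split=> //=.
  by rewrite phiE; congr (- _); apply: eq_bigr => i /xS.
move=> i iS; have {}xS : \sum_(i in S) (al i x - N i) = 0.
  by rewrite sumrB; apply/eqP; rewrite subr_eq0 -eqr_opp -phiE; apply/eqP.
apply/eqP; rewrite -subr_eq0; apply/eqP; move: i iS.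
apply/psumr_eq0P => //.
by move=> i _; rewrite subr_ge0; case: Ax.
Qed.

Lemma face_tight_face F : nonempty_face A F -> exists2 S, realized S & F = tight_face S.
Proof.
move=> [[phi [b [phib FE]]] F0].
have FA x : F x -> A x by rewrite FE; case.
have exm : exists m, `[< exists2 x, F x & #|tight x| = m >].
  by case: F0 => x Fx; exists #|tight x|; apply/asboolP; exists x.
case: (ex_minnP exm) => m /asboolP[x Fx xm] mmin.
have Ax := FA _ Fx; exists (tight x); first by exists x.
have phix : phi x = b by move: Fx; rewrite FE => -[].
apply/seteqP; split=> y.
  move=> Fy; have Ay := FA _ Fy; split=> // i it.
  pose z := 2^-1 *: x + 2^-1 *: y.
  have alz j : al j z = (al j x + al j y) / 2 by rewrite alD !alZ; lra.
  have Az : A z.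
    split; last by move=> j; rewrite alz; case: Ax Ay => _ /(_ j) + [_ /(_ j)]; lra.
    have -> : z - o = 2^-1 *: (x - o) + 2^-1 *: (y - o).
      rewrite /z !scalerBr addrACA -opprD -scalerDl (_ : 2^-1 + 2^-1 = 1) ?scale1r//.
      by lra.
    by apply: DP; [case: Ax|apply: DZ; case: Ay].
  have phiy : phi y = b by move: Fy; rewrite FE => -[].
  have Fz : F z.
    rewrite FE; split=> //=; rewrite linearD !linearZ /= phix phiy.
    by rewrite -[_ *: _]/(_ * _); lra.
  have zx : tight z \subset tight x.
    apply/fintype.subsetP => j; rewrite !inE alz => /eqP jz.
    by case: Ax Ay => _ /(_ j) jx [_ /(_ j) jy]; apply/eqP; lra.
  have /eqP zE : tight z == tight x.
    by rewrite eqEcard zx xm; apply: mmin; apply/asboolP; exists z.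
  move: it; rewrite -zE inE alz => /eqP jz.
  by case: Ax Ay => _ /(_ i) jx [_ /(_ i) jy]; lra.
move=> [Ay xy]; rewrite FE; split=> //=; apply/eqP.
have [s s0 Az] : exists2 s : R, 0 < s & A (x + s *: (x - y)).
  apply: small_step => //; first exact: DBo.
  by move=> i it; rewrite alB (tightP it) xy// subrr.
rewrite eq_le phib//=.
have := phib _ Az; rewrite linearD linearZ linearB /= phix.
by rewrite -[_ *: _]/(_ * _) gerDl pmulr_rle0// subr_le0.
Qed.

Lemma tight_face_dim (S M : {set I}) : max_realized M -> S \subset M ->
  has_dim (tight_face S) #|M :\: S|.
Proof.
move=> Mmax SM; have [q Aq qM] := proj1 Mmax.
have /choice[y yP] : forall i, exists p, A p /\ tight p = M :\ i.
  move=> i; have [|p Ap tp] := @realized_sub M (M :\ i) (proj1 Mmax).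
    exact: finset.subsetDl.
  by exists p.
pose t (k : 'I_#|M :\: S|) := enum_val k.
have tM k : t k \in M by have := enum_valP k; rewrite inE => /andP[].
have tS k : t k \notin S by have := enum_valP k; rewrite inE => /andP[].
have Ay i : A (y i) by case: (yP i).
have alq i : i \in M -> al i q = N i by rewrite -qM; exact: tightP.
have aly i j : i \in M -> i != j -> al i (y j) = N i.
  by move=> iM ij; apply: tightP; rewrite (proj2 (yP j)) !inE ij.
have aly_neq i : i \in M -> al i (y i) - N i != 0.
  move=> iM; rewrite subr_eq0; apply/negP => e.
  have : i \in tight (y i) by rewrite inE.
  by rewrite (proj2 (yP i)) !inE eqxx.
have al_comb (a : 'I_#|M :\: S| -> R) k :
    al (t k) (\sum_l a l *: (y (t l) - q)) = a k * (al (t k) (y (t k)) - N (t k)).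
  rewrite al_sum (bigD1 k)//= alZ alB alq// big1 ?addr0// => l lk.
  rewrite alZ alB alq// aly ?subrr ?mulr0//.
  by apply: contraNneq lk => /enum_val_inj ->.
apply: (@has_dim_base _ _ _ _ q (fun k => y (t k) - q)).
- by split=> // i /(fintype.subsetP SM); exact: alq.
- move=> k; rewrite subrKC; split=> // i iS; apply: aly.
    exact: (fintype.subsetP SM).
  by apply: contraTneq iS => ->.
- move=> a a0 k; have := al_comb a k; rewrite a0 al0 => /esym/eqP.
  by rewrite mulf_eq0 (negbTE (aly_neq _ _)) ?orbF// => /eqP.
- move=> x [Ax xS].
  pose c k := (al (t k) x - N (t k)) / (al (t k) (y (t k)) - N (t k)).
  exists c; apply/eqP; rewrite -subr_eq0 opprD addrA; apply/eqP.
  apply: (@max_realized_dir q) => //; first by rewrite qM.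
    apply: DB; first exact: DBo.
    by apply: Dsum => k; apply: DZ; exact: DBo.
  rewrite qM => i iM; rewrite !alB alq//; have [iS|iS] := boolP (i \in S).
    rewrite xS// subrr sub0r al_sum big1 ?oppr0// => k _.
    rewrite alZ alB alq// aly ?subrr ?mulr0//.
    by apply: contraTneq iS => ->.
  have iMS : i \in M :\: S by rewrite inE iS.
  have -> : i = t (enum_rank_in iMS i) by rewrite /t enum_rankK_in.
  by rewrite al_comb /c divfK ?subrr// aly_neq.
Qed.

Variables (d : nat) (e : 'I_d -> V).
Hypothesis A_neq0 : A !=set0.
Hypothesis De : forall k, D (e k).
Hypothesis e_indep : forall a : 'I_d -> R, \sum_k a k *: e k = 0 -> forall k, a k = 0.
Hypothesis e_span : forall w, D w -> exists a : 'I_d -> R, w = \sum_k a k *: e k.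

Lemma realized0 : realized finset.set0.
Proof.
have [p Ap] := A_neq0.
by apply: (@realized_sub (tight p)); [exists p|exact: finset.sub0set].
Qed.

Lemma polyhedron_dim : has_dim A d.
Proof.
have [q Aq q0] := realized0.
have /choice[s sP] : forall k, exists s : R, 0 < s /\ A (q + s *: e k).
  move=> k; have [|s s0 As] := @small_step q (e k) Aq (De k); last by exists s.
  by move=> i; rewrite q0 inE.
have s_neq0 k : s k != 0 by rewrite gt_eqF//; case: (sP k).
apply: (@has_dim_base _ _ _ _ q (fun k => s k *: e k)) => //.
- by move=> k; case: (sP k).
- move=> a a0 k; apply: (mulIf (s_neq0 k)); rewrite mul0r.
  move: k; apply: e_indep; rewrite -[RHS]a0; apply: eq_bigr => k _.
  by rewrite scalerA.
- move=> x Ax; have [a aE] := e_span (DBo Ax Aq).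
  exists (fun k => a k / s k); rewrite -[LHS](subrKC q) aE; congr (_ + _).
  by apply: eq_bigr => k _; rewrite scalerA divfK.
Qed.

Lemma tight_face0 : tight_face finset.set0 = A.
Proof. by apply/seteqP; split=> [x []|x Ax]//; split=> // i; rewrite inE. Qed.

Lemma card_max_realized M : max_realized M -> #|M| = d.
Proof.
move=> Mmax; have := tight_face_dim Mmax (finset.sub0set M).
by rewrite finset.setD0 tight_face0 => /has_dim_uniq; apply; exact: polyhedron_dim.
Qed.

Lemma tight_face_dim_card S : realized S -> has_dim (tight_face S) (d - #|S|).
Proof.
move=> /max_realized_ex[M Mmax SM]; have := tight_face_dim Mmax SM.
by rewrite cardsD (finset.setIidPr SM) card_max_realized.
Qed.

Lemma card_realized S : realized S -> (#|S| <= d)%N.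
Proof.
move=> /max_realized_ex[M Mmax SM].
by rewrite -(card_max_realized Mmax) subset_leq_card.
Qed.

Lemma realized_card_max S : realized S -> #|S| = d -> max_realized S.
Proof.
move=> rS Sd; split=> // S' rS' SS'; apply/eqP; rewrite eq_sym eqEcard SS' Sd.
exact: card_realized.
Qed.

Lemma vertex_tight_face S : realized S -> (vertex A (tight_face S) <-> max_realized S).
Proof.
move=> rS; split=> [[_ dS]|Smax].
  apply: realized_card_max => //; apply/eqP; rewrite eqn_leq card_realized//=.
  by rewrite -subn_eq0 (has_dim_uniq (tight_face_dim_card rS) dS).
split; first exact: tight_face_face.
by have := tight_face_dim_card rS; rewrite card_max_realized// subnn.
Qed.

Lemma facet_tight_face S : realized S -> (facet A (tight_face S) <-> #|S| = 1%N).
Proof.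
move=> rS; have Sd := card_realized rS; split.
  move=> [_ [m [mS mA]]].
  have dE := has_dim_uniq polyhedron_dim mA.
  have := has_dim_uniq (tight_face_dim_card rS) mS.
  by rewrite dE in Sd *; lia.
move=> S1; split; first exact: tight_face_face.
exists d.-1; rewrite S1 in Sd; rewrite prednK//; split; last exact: polyhedron_dim.
by have := tight_face_dim_card rS; rewrite S1 subn1.
Qed.

Lemma polyhedron_simple : simple_polytope A d.
Proof.
split; [exact: polyhedron_polytope|exact: polyhedron_dim|].
move=> F vF; have [F0 dF] := vF.
have [|S rS FE] := @face_tight_face F.
  by split=> //; case: dF => p [Fp _ _]; exists (p ord0).
rewrite {}FE in vF dF F0 *.
have Smax := (vertex_tight_face rS).1 vF.
have rS1 i : i \in S -> realized [set i]%SET.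
  by move=> iS; apply: realized_sub rS _; rewrite finset.sub1set.
have -> : [set G | facet A G /\ tight_face S `<=` G] =
    (fun i => tight_face [set i]%SET) @` [set i | i \in S].
  apply/seteqP; split=> [G [fG SG]|_ [i /= iS <-]]; last first.
    split; first by apply/facet_tight_face; [exact: rS1|rewrite cards1].
    by apply/tight_face_sub => //; rewrite finset.sub1set.
  have [|S' rS' GE] := @face_tight_face G.
    split; first by case: fG.
    by case: fG => _ [m [[p [Gp _ _]] _]]; exists (p ord0).
  rewrite GE in fG SG *; have /cards1P[i S'E] : #|S'| == 1%N.
    exact/eqP/facet_tight_face.
  exists i => /=; last by rewrite S'E.
  by move: SG => /(tight_face_sub _ rS); rewrite S'E finset.sub1set.
rewrite -(card_max_realized Smax).
apply: card_eq_trans (inj_card_eq _) _.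
  move=> i j; rewrite !inE => iS jS ij.
  have : [set j]%SET \subset [set i]%SET.
    by apply/(tight_face_sub _ (rS1 _ iS)); rewrite ij.
  by rewrite finset.sub1set inE => /eqP.
have -> : [set i | i \in S] = [set` [fset i in S]%fset].
  by apply/seteqP; split=> i /=; rewrite !inE.
by apply/card_eq_fsetP; rewrite card_finset.
Qed.

End Polyhedron.

(** * The realization *)

Section TubeOrbits.
Variables (n : nat) (P : affine_poset n).
Hypothesis n_gt0 : (0 < n)%N.
Implicit Types (i j k : int) (s t : set int) (T : set (set int)).

Lemma finite_tubes_at :
  finite_set [set t | proper_tube P t /\ exists2 i, t i & 0 <= i < n%:Z].
Proof.
have [B tB] := proper_tube_bounded P n_gt0.
have /finite_fsetP[F FE] := finite_int_range (- B) (n%:Z + B).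
apply: sub_finite_set (finite_image (fun A : {fset int} => [set` A])
  (finite_fset (fpowerset F))) => t /= [tP [i ti i0n]].
have tF : t `<=` [set` F].
  rewrite -FE => j tj /=; have := tB _ _ _ tP ti tj; have := tB _ _ _ tP tj ti; lia.
have tf := finite_proper_tube n_gt0 tP.
exists (fset_set t); last by rewrite fset_setK.
by rewrite /= fpowersetE -(set_fsetK F) -fset_set_sub.
Qed.

Lemma tube_orbits : exists (I : finType) (rp : I -> set int),
  [/\ forall a, proper_tube P (rp a),
      forall t, proper_tube P t -> exists a k, t = shift_set n (rp a) k &
      forall a b k, rp a = shift_set n (rp b) k -> a = b].
Proof.
pose orb t := [set s | exists k, s = shift_set n t k].
pose can t := xget set0 (orb t).
have canP t : orb t (can t).
  by apply: (@xgetPex _ set0 (orb t)); exists t; exists 0; rewrite shift_set0.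
have orb_shift t k : orb (shift_set n t k) = orb t.
  apply/seteqP; split=> s [l ->].
    by exists (k + l); rewrite shift_setD.
  by exists (l - k); rewrite shift_setD addrC subrK.
have can_shift t k : can (shift_set n t k) = can t by rewrite /can orb_shift.
pose W := [set t | proper_tube P t /\ exists2 i, t i & 0 <= i < n%:Z].
have /finite_fsetP[K KE] := finite_image can finite_tubes_at.
exists K, (fun a => fsval a).
have inK t : t \in K <-> exists2 s, W s & can s = t.
  by have := congr1 (fun A => A t) KE => /= <-.
split.
- move=> a; have /inK[s [sP _] <-] := fsvalP a.
  by have [k ->] := canP s; exact: proper_tube_shift.
- move=> t tP; have [i ti] := proper_tube_neq0 tP.
  pose q := (i %/ n%:Z)%Z.
  have tK : can t \in K.
    apply/inK; exists (shift_set n t (- q)); last exact: can_shift.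
    split; first exact: proper_tube_shift.
    exists (i %% n%:Z)%Z.
      rewrite shift_setE mulNr opprK addrC -divz_eq//.
    by rewrite modz_ge0 ?ltz_pmod//=; lia.
  exists [` tK]%fset => /=; have [k kE] := canP t; exists (- k).
  by rewrite kE shift_setK.
- move=> a b k; have /inK[s sW sa] := fsvalP a; have /inK[s' sW' sb] := fsvalP b.
  move=> ab; apply: val_inj => /=.
  have canK u : can (can u) = can u.
    by have [l] := canP u => {1}->; rewrite can_shift.
  by rewrite -sa -(canK s) sa ab can_shift -sb canK.
Qed.

End TubeOrbits.

Section Tubings.
Variables (n : nat) (P : affine_poset n).
Implicit Types (t : set int) (T : set (set int)).

Lemma proper_tubing_sub T T' : proper_tubing P T -> T' `<=` T ->
  (forall t k, T' t -> T' (shift_set n t k)) -> proper_tubing P T'.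
Proof.
move=> [TP _ Tnd Tac] T'T T's; split=> //.
- by move=> t /T'T; exact: TP.
- by move=> s t /T'T Ts /T'T Tt; exact: Tnd.
- by move=> k t tT; apply: Tac => l lk; apply/T'T/tT.
Qed.

Lemma proper_tubing0 : proper_tubing P set0.
Proof. by split=> // k t /(_ _ (leqnn k)). Qed.

Variables (I : finType) (rp : I -> set int).
Hypothesis rpP : forall a, proper_tube P (rp a).
Hypothesis rp_ex : forall t, proper_tube P t -> exists a k, t = shift_set n (rp a) k.
Hypothesis rp_uniq : forall a b k, rp a = shift_set n (rp b) k -> a = b.

Definition orbit_index T : {set I} := [set a | `[< T (rp a) >]]%SET.

Lemma mem_orbit_index T a : a \in orbit_index T <-> T (rp a).
Proof. by rewrite inE; split=> [/asboolP|Ta]; [|apply/asboolP]. Qed.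

Lemma orbit_indexP T t : proper_tubing P T ->
  T t <-> exists a k, t = shift_set n (rp a) k /\ a \in orbit_index T.
Proof.
move=> TP; split=> [Tt|[a [k [-> ]]]].
  have [a [k tE]] := rp_ex (tubing_tube TP Tt); exists a, k; split=> //.
  apply/mem_orbit_index; rewrite -(shift_setK n (rp a) k) -tE.
  exact: (tubing_shift TP).
by move=> /mem_orbit_index; exact: (tubing_shift TP).
Qed.

Lemma orbit_index_sub T1 T2 : proper_tubing P T1 -> proper_tubing P T2 ->
  (orbit_index T1 \subset orbit_index T2 <-> T1 `<=` T2).
Proof.
move=> TP1 TP2; split=> [/fintype.subsetP sub t|sub].
  move=> /(orbit_indexP _ TP1)[a [k [-> /sub aT]]].
  by apply/(orbit_indexP _ TP2); exists a, k.
by apply/fintype.subsetP => a /mem_orbit_index Ta; apply/mem_orbit_index; exact: sub.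
Qed.

Lemma orbit_index_inj T1 T2 : proper_tubing P T1 -> proper_tubing P T2 ->
  orbit_index T1 = orbit_index T2 -> T1 = T2.
Proof.
by move=> TP1 TP2 E; apply/seteqP; split; apply/orbit_index_sub => //; rewrite E.
Qed.

Lemma orbit_index_restrict T (S : {set I}) : proper_tubing P T ->
  S \subset orbit_index T -> exists2 T', proper_tubing P T' & orbit_index T' = S.
Proof.
move=> TP /fintype.subsetP ST.
pose T' := [set t | exists a k, t = shift_set n (rp a) k /\ a \in S].
exists T'.
  apply: (proper_tubing_sub TP).
    by move=> t [a [k [-> /ST/mem_orbit_index]]]; exact: (tubing_shift TP).
  by move=> _ l [a [k [-> aS]]]; exists a, (k + l); rewrite shift_setD.
apply/finset.setP => a; apply/idP/idP => [/mem_orbit_index[b [k [/rp_uniq -> //]]]|aS].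
by apply/mem_orbit_index; exists a, 0; rewrite shift_set0.
Qed.

End Tubings.

Section Quotient.
Variable R : realType.
Local Notation Q := (seq_mod_cst R).
Implicit Types (x y w : int -> R^o).

Lemma pi_seq_scale (a : R) x : a *: \pi_Q x = \pi_Q (a *: x).
Proof. by rewrite pi_seq_modZ. Qed.

Lemma pi_seq_sub x y : \pi_Q (x - y) = \pi_Q x - \pi_Q y.
Proof. by rewrite -scaleN1r pi_seq_modD -pi_seq_scale scaleN1r. Qed.

Lemma pi_seq0 : \pi_Q 0 = 0.
Proof. by rewrite -(subrr (0 : int -> R^o)) pi_seq_sub subrr. Qed.

Lemma pi_seq_eq x y : \pi_Q x = \pi_Q y <-> exists r, x = y + cst r.
Proof. by split=> [/eqP/seq_mod_cstP//|/seq_mod_cstP/eqP]. Qed.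

Lemma pi_seq_sum (J : Type) (r : seq J) (F : J -> int -> R^o) :
  \pi_Q (\sum_(j <- r) F j) = \sum_(j <- r) \pi_Q (F j).
Proof.
exact: (big_morph _ (@pi_seq_modD R) pi_seq0).
Qed.

Variables (n : nat) (P : affine_poset n).
Hypothesis n_gt0 : (0 < n)%N.

Definition periodic w := forall i, w (i + n%:Z) = w i.

Definition periodic_dir : set Q := [set \pi_Q w | w in periodic].
Local Notation D := periodic_dir.

Lemma periodic_shift w i k : periodic w -> w (i + k * n%:Z) = w i.
Proof.
move=> wn; have wN (m : nat) j : w (j + m%:Z * n%:Z) = w j.
  elim: m => [|m IH]; first by rewrite mul0r addr0.
  by rewrite intS mulrDl mul1r (addrC n%:Z) addrA wn.
case: k => m; first exact: wN.
by rewrite -(wN m.+1 (i + _)); congr w; rewrite NegzE; ring.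
Qed.

Lemma periodic_modz w i : periodic w -> w i = w (i %% n%:Z)%Z.
Proof.
by move=> wn; rewrite [in LHS](divz_eq i n%:Z) addrC periodic_shift.
Qed.

Lemma periodic_dir0 : D 0.
Proof. by exists 0 => //; exact: pi_seq0. Qed.

Lemma periodic_dirP (a : R) u v : D u -> D v -> D (a *: u + v).
Proof.
move=> [x xn <-] [y yn <-]; exists (a *: x + y).
  by move=> i; rewrite !fctE xn yn.
by rewrite pi_seq_modD pi_seq_scale.
Qed.

Lemma alpha_linear t (a : R) (u v : Q) : finite_set t ->
  alpha P t (a *: u + v) = a * alpha P t u + alpha P t v.
Proof.
move=> tf; elim/quotW: u => x; elim/quotW: v => y.
by rewrite pi_seq_scale -pi_seq_modD !alpha_pi alpha_seqD// alpha_seqZ.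
Qed.

Lemma realization_space_dir x p : quasi_periodic n x ->
  (@realization_space R n p <-> D (p - \pi_Q x)).
Proof.
move=> xq; split=> [[y yq <-]|[w wn wE]].
  rewrite -pi_seq_sub; exists (y - x) => //.
  by move=> i; rewrite !fctE xq yq opprD addrACA subrr addr0.
exists (w + x); last by rewrite pi_seq_modD wE subrK.
by move=> i; rewrite !fctE wn xq addrA.
Qed.

Lemma periodic_dir_bounded (w : Q) : D w ->
  (forall t, proper_tube P t -> 0 <= alpha P t w) -> w = 0.
Proof.
move=> [x xn <-] x0.
have cov i j : ap_cover P i j -> x i <= x j.
  move=> ij; have [/eqP ijn|ijn] := boolP (i == j %[mod n%:Z])%Z.
    by rewrite (periodic_modz i xn) (periodic_modz j xn) ijn.
  have := x0 _ (cover_proper_tube n_gt0 ij ijn).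
  by rewrite alpha_pi alpha_seq_pair// subr_ge0.
have le i j : P i j -> x i <= x j.
  apply: (ap_cover_ind n_gt0 (Q := fun i j => x i <= x j)) => //.
  by move=> a b c _ _; exact: le_trans.
have x_le i j : x i <= x j.
  by have [k /le] := ap_cofinal P i j; rewrite periodic_shift.
rewrite -pi_seq0; apply/pi_seq_eq; exists (x 0); apply/funext => i.
by rewrite !fctE add0r; apply/eqP; rewrite eq_le !x_le.
Qed.

Definition residue_dir (k : 'I_n.-1) : int -> R^o :=
  fun i => ((i %% n%:Z)%Z == (k.+1)%:Z)%:R.

Lemma residue_dir_periodic k : periodic (residue_dir k).
Proof. by move=> i; rewrite /residue_dir modzDr. Qed.

Lemma residue_dir_small k (m : nat) : (m < n)%N ->
  residue_dir k m%:Z = (m == k.+1)%:R.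
Proof. by move=> mn; rewrite /residue_dir modz_small//; lia. Qed.

Lemma sum_residue_dir (a : 'I_n.-1 -> R) i :
  (\sum_k a k *: residue_dir k) i = \sum_k a k * residue_dir k i.
Proof. by rewrite fct_sumE. Qed.

Lemma residue_dir_indep (a : 'I_n.-1 -> R) :
  \sum_k a k *: \pi_Q (residue_dir k) = 0 -> forall k, a k = 0.
Proof.
move=> a0; have : \pi_Q (\sum_k a k *: residue_dir k) = \pi_Q 0.
  rewrite pi_seq_sum pi_seq0 -[RHS]a0; apply: eq_bigr => k _.
  by rewrite pi_seq_scale.
move=> /pi_seq_eq[r /(congr1 (fun f : int -> R^o => f _))E].
have {}E i : \sum_k a k * residue_dir k i = r.
  by have := E i; rewrite sum_residue_dir !fctE add0r.
have r0 : r = 0.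
  rewrite -(E 0%:Z) big1// => k _; rewrite (residue_dir_small _ n_gt0).
  by rewrite mulr0.
move=> k; have kn : (k.+1 < n)%N by have := ltn_ord k; lia.
have := E k.+1%:Z; rewrite r0 (bigD1 k)//= residue_dir_small// eqxx mulr1.
rewrite big1 ?addr0// => l lk; rewrite residue_dir_small// eqSS.
by rewrite eq_sym (inj_eq val_inj) (negbTE lk) mulr0.
Qed.

Lemma residue_dir_span (w : Q) : D w ->
  exists a : 'I_n.-1 -> R, w = \sum_k a k *: \pi_Q (residue_dir k).
Proof.
move=> [x xn <-]; exists (fun k : 'I_n.-1 => x (k.+1)%:Z - x 0).
rewrite (eq_bigr (fun k : 'I_n.-1 => \pi_Q ((x (k.+1)%:Z - x 0) *: residue_dir k))).
  rewrite -pi_seq_sum; apply/pi_seq_eq; exists (x 0); apply/funext => i.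
  rewrite !fctE sum_residue_dir (periodic_modz i xn).
  have r0 : 0 <= (i %% n%:Z)%Z by rewrite modz_ge0//; lia.
  have rn : (i %% n%:Z)%Z < n%:Z by rewrite ltz_pmod//; lia.
  case: (absz (i %% n%:Z)%Z) (gez0_abs r0) => [|m] mE.
    by rewrite big1 ?add0r -?mE// => k _; rewrite /residue_dir -mE mulr0.
  have mn : (m < n.-1)%N by lia.
  rewrite (bigD1 (Ordinal mn))//= /residue_dir -mE eqxx mulr1 big1 ?addr0 ?subrK//.
  move=> k /eqP km; rewrite eqz_nat eqSS; case: eqP => [mk|]; last by rewrite mulr0.
  by case: km; apply: val_inj; rewrite /= mk.
by move=> k _; rewrite pi_seq_scale.
Qed.

End Quotient.

Theorem theorem2p8 (R : realType) (n : nat) (n_gt0 : (0 < n)%N)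
    (P : affine_poset n) :
  simple_polytope (cyclohedron_realization R P) n.-1 /\
  exists Phi : set (set int) -> set (seq_mod_cst R),
    [/\ set_bij (proper_tubing P)
                (nonempty_face (cyclohedron_realization R P)) Phi,
        forall T1 T2, proper_tubing P T1 -> proper_tubing P T2 ->
          (Phi T1 `<=` Phi T2 <-> T2 `<=` T1) &
        forall T, proper_tubing P T ->
          (vertex (cyclohedron_realization R P) (Phi T) <->
           maximal_tubing P T)].
Proof.
have [I [rp [rpP rp_ex rp_uniq]]] := tube_orbits P n_gt0.
have [xo [oq oA _]] := realize_tubing R n_gt0 (proper_tubing0 P).
pose o := \pi_(seq_mod_cst R) xo.
pose D := @periodic_dir R n.
pose al (a : I) (p : seq_mod_cst R) := alpha P (rp a) p.
pose N a := tube_bound R n (rp a).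
have alL a (r : R) u v : al a (r *: u + v) = r * al a u + al a v.
  by apply: alpha_linear; exact: finite_proper_tube (rpP a).
have AE : cyclohedron_realization R P = polyhedron D o al N.
  apply/seteqP; split=> p.
    move=> [/(realization_space_dir _ oq) Dp Ap]; split=> // a.
    exact: Ap (rpP a).
  move=> [Dp Ap]; have pL : realization_space n p.
    exact/(realization_space_dir _ oq).
  split=> // t tP; have [a [k tE]] := rp_ex _ tP; have [x xq xp] := pL.
  rewrite /tube_halfspace /= tE (card_shift_set n_gt0 k (rpP a)) -xp alpha_pi.
  by rewrite alpha_seq_period// -(alpha_pi P (rp a) x) xp; exact: Ap.
pose real := realized D o al N.
have ot x p : p = \pi_(seq_mod_cst R) x ->
    tight al N p = orbit_index rp (tight_tubes P x).
  move=> ->; apply/finset.setP => a.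
  apply/idP/idP => [/tightP e|/mem_orbit_index[_ e]].
    by apply/mem_orbit_index; split=> //; rewrite -(alpha_pi P (rp a) x).
  by rewrite inE; apply/eqP; rewrite /al alpha_pi.
have realP S : real S <-> exists2 T, proper_tubing P T & orbit_index rp T = S.
  split=> [[p Ap <-]|[T TP <-]].
    have : cyclohedron_realization R P p by rewrite AE.
    move=> [[x xq xp] xA]; exists (tight_tubes P x); last by rewrite (ot x).
    apply: tight_tubing => // t tP; have := xA _ tP.
    by rewrite /tube_halfspace /= -xp alpha_pi.
  have [x [xq xA xT]] := realize_tubing R n_gt0 TP.
  exists (\pi_(seq_mod_cst R) x); last by rewrite (ot x)// xT.
  rewrite -AE; split; first by exists x.
  by move=> t tP; rewrite /tube_halfspace /= alpha_pi; exact: xA.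
have realS T : proper_tubing P T -> real (orbit_index rp T).
  by move=> TP; apply/realP; exists T.
have bnd w : D w -> (forall a, 0 <= al a w) -> w = 0.
  move=> Dw w0; apply: (periodic_dir_bounded n_gt0 Dw) => t tP.
  have [a [k ->]] := rp_ex _ tP; have := w0 a; case: Dw => x xn <-.
  rewrite /al !alpha_pi (@alpha_seq_shift _ _ P (rp a) k x x 0)//.
    exact: finite_proper_tube (rpP a).
  by move=> i _; rewrite addr0 periodic_shift.
have realD (S S' : {set I}) : real S -> S' \subset S -> real S'.
  move=> /realP[T TP <-] /(orbit_index_restrict rp_uniq TP)[T' TP' <-].
  exact: realS.
have D0 := @periodic_dir0 R n.
have DP := @periodic_dirP R n.
have A0 : polyhedron D o al N !=set0.
  by have [p Ap _] := realS _ (proper_tubing0 P); exists p.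
have De k : D (\pi_(seq_mod_cst R) (@residue_dir R n k)).
  by exists (residue_dir R k) => //; exact: residue_dir_periodic.
have eI := @residue_dir_indep R n n_gt0.
have eS := @residue_dir_span R n n_gt0.
have face_sub := tight_face_sub (D := D) (o := o) (al := al) (N := N).
rewrite AE; split.
  exact: (polyhedron_simple D0 DP alL bnd realD A0 De eI eS).
exists (fun T => tight_face D o al N (orbit_index rp T)); split.
- split.
  + move=> T TP; split; first exact: tight_face_face.
    by have [p Ap <-] := realS _ TP; exists p; exact: tight_face_tight.
  + move=> T1 T2 /set_mem TP1 /set_mem TP2 E; apply: (orbit_index_inj rp_ex TP1 TP2).
    apply/eqP; rewrite finset.eqEsubset; apply/andP; split.
      by apply/(face_sub _ _ (realS _ TP2)); rewrite E.
    by apply/(face_sub _ _ (realS _ TP1)); rewrite E.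
  + move=> F /(face_tight_face D0 DP alL)[S /realP[T TP <-] ->].
    by exists T.
- move=> T1 T2 TP1 TP2; rewrite face_sub; last exact: realS.
  exact: (orbit_index_sub rp_ex TP2 TP1).
- move=> T TP.
  rewrite (vertex_tight_face D0 DP alL bnd realD A0 De eI eS (realS _ TP)).
  split=> [[_ Tmax]|[_ Tmax]]; split=> //.
  + move=> T' TP' TT'; apply: (orbit_index_inj rp_ex) => //.
    by apply: Tmax; [exact: realS|exact/(orbit_index_sub rp_ex)].
  + exact: realS.
  + move=> S' /realP[T' TP' <-] /(orbit_index_sub rp_ex TP TP') TT'.
    by rewrite (Tmax _ TP' TT').
Qed.
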